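(* There is an absolute constant $C>0$ such that for all $\eta,\varepsilon,\delta\in(0,1/2]$ there exists an algorithm $\mathcal{A}$ (for the infinite-armed Bernoulli bandit described in the context, not knowing the reservoir distribution $\mu$) such that for every reservoir distribution $\mu$: (i) $\mathcal{A}$ is $(\eta,\varepsilon,\delta)$-PAC, i.e. its output arm $a_{i^*}$ satisfies $\mathbb{P}\big[p_{i^*}\ge G_\mu^{-1}(1-\eta)-\varepsilon\big]\ge 1-\delta$ (if the algorithm outputs no arm this counts as failure); and (ii) the expected number of samples $\mathbb{E}[T]$ used by $\mathcal{A}$ is at most $C\,\frac{\log(1/\delta)\log(1/\eta)}{\eta\varepsilon^2}$.
   Context: Infinite-armed Bernoulli bandit: a reservoir distribution $\mu$ is any Borel probability measure on $[0,1]$. There are countably many arms $a_1,a_2,\dots$ whose means $p_1,p_2,\dots$ are drawn i.i.d. from $\mu$ (unknown to the algorithm). Each time arm $a_i$ is sampled it returns a reward in $\{0,1\}$ distributed as Bernoulli$(p_i)$, independently of all other rewards given the means. An algorithm, at each time step, chooses (based on all previously observed rewards and possibly internal randomness) an arm to sample; at some (random) stopping time $T$ it stops and outputs an arm index $i^*$. Its sample complexity is $T$. Probabilities and expectations are over the means, the rewards and the algorithm's randomness. Write $G_\mu(\tau)=\mu([0,\tau])$ and $G_\mu^{-1}(p)=\inf\{\tau: G_\mu(\tau)\ge p\}$. *)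

(* Defs.v *)
From HB Require Import structures.
From mathcomp Require Import all_boot all_order all_algebra.
From mathcomp Require Import all_classical all_reals all_analysis.
Set Implicit Arguments. Unset Strict Implicit. Unset Printing Implicit Defensive.
Import Order.TTheory GRing.Theory Num.Theory.
Local Open Scope classical_set_scope.
Local Open Scope ring_scope.

Inductive action := Pull of nat | Stop of option nat.

(** A (possibly randomized) algorithm: given its internal random seed
    [u : R] and the history of (arm, reward) pairs observed so far, it
    chooses the next action. *)
Definition algorithm (R : realType) := R -> seq (nat * bool) -> action.

Definition alg_measurable (R : realType) (A : algorithm R) :=
  forall (h : seq (nat * bool)) (a : action), measurable [set u : R | A u h = a].

(** Execution state: still running with history [h], or stopped after
    [t] samples with output [o]. *)
Inductive state := Running of seq (nat * bool) | Done of nat & option nat.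

Definition nb_pulls (h : seq (nat * bool)) (i : nat) : nat :=
  count (fun ab => ab.1 == i) h.

(** One step. [x i k] is the reward returned by the (k+1)-th sample of
    arm [i] (reward-table model of the bandit). *)
Definition step (R : realType) (A : algorithm R) (u : R)
    (x : nat -> nat -> bool) (s : state) : state :=
  match s with
  | Done t o => Done t o
  | Running h =>
      match A u h with
      | Pull i => Running (rcons h (i, x i (nb_pulls h i)))
      | Stop o => Done (size h) o
      end
  end.

Definition exec (R : realType) (A : algorithm R) (u : R)
    (x : nat -> nat -> bool) (n : nat) : state :=
  iter n (step A u x) (Running [::]).

Definition samples_at (s : state) : nat :=
  match s with Running h => size h | Done t _ => t end.

(** Sample complexity T (possibly +oo if the algorithm never stops). *)
Definition sample_complexity (R : realType) (A : algorithm R) (u : R)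
    (x : nat -> nat -> bool) : \bar R :=
  ereal_sup [set ((samples_at (exec A u x n))%:R)%:E | n in [set: nat]].

Definition outputs (R : realType) (A : algorithm R) (u : R)
    (x : nat -> nat -> bool) (i : nat) : Prop :=
  exists n t, exec A u x n = Done t (Some i).

(** [G_mu tau = mu([0,tau])] (mu is supported on [0,1]). *)
Definition Gmu (R : realType) (mu : probability R R) (tau : R) : \bar R :=
  mu `[0, tau]%classic.

Definition Gmu_inv (R : realType) (mu : probability R R) (p : R) : R :=
  inf [set tau : R | (p%:E <= Gmu mu tau)%E].

Definition bern (R : realType) (q : R) (b : bool) : R := if b then q else 1 - q.

(** * The probabilistic model

    [p i] is the mean of arm [i], [X i k] the reward of the (k+1)-th sample
    of arm [i], [U] the internal random seed of the algorithm.  The model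
    requires:
    - the seed [U] is uniform on [0,1], the means are i.i.d. with law [mu],
      and [U], [p 0], [p 1], ... are mutually independent;
    - conditionally on ([U], means), the rewards [X i k] are independent,
      [X i k] being Bernoulli([p i]). *)
Definition bandit_model (R : realType) (mu : probability R R)
    (d : measure_display) (Omega : measurableType d)
    (P : probability Omega R) (p : nat -> Omega -> R)
    (X : nat -> nat -> Omega -> bool) (U : Omega -> R) : Prop :=
  [/\ measurable_fun setT U,
      (forall i, measurable_fun setT (p i)),
      (forall i k, measurable [set w | X i k w]),
      (forall (F : seq nat) (B : nat -> set R) (E : set R),
          uniq F -> measurable E -> (forall i, measurable (B i)) ->
          P [set w | E (U w) /\ forall i, i \in F -> B i (p i w)]
          = (lebesgue_measure (E `&` `[0%R, 1%R]%classic) *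
             (\prod_(i <- F) fine (mu (B i)))%:E)%E) &
      (forall (F : seq nat) (B : nat -> set R) (E : set R)
              (K : seq (nat * nat)) (b : nat * nat -> bool),
          uniq F -> uniq K -> measurable E -> (forall i, measurable (B i)) ->
          P [set w | (E (U w) /\ forall i, i \in F -> B i (p i w)) /\
                     forall ik, ik \in K -> X ik.1 ik.2 w = b ik]
          = (\int[P]_(w in [set w | E (U w) /\ forall i, i \in F -> B i (p i w)])
               (\prod_(ik <- K) bern (p ik.1 w) (b ik))%:E)%E)].

(* Main.v *)
(** The algorithm screens n ~ log(1/delta)/eta arms with m1 ~ log(1/eta)/eps^2
    pulls each and takes as threshold theta the empirical upper eta/2-quantile of
    the reward sums.  It then goes through the arms whose sum reaches theta, in
    order, giving each m2 ~ (log(1/eta) + log(1/delta))/eps^2 fresh pulls, and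
    outputs the first one whose fresh average is at least theta/m1 - 2 eps/5.

    Call an arm discrepant when its two averages differ by more than 2 eps/5.
    This has probability at most eta/16, and an arm can only fail its second test
    if it is discrepant.  Let t0 be the true upper eta/4-quantile of the screening
    sum.  By Chernoff, theta <= t0 and theta/m1 >= G^-1(1 - eta) - 2 eps/5 up to
    probability O(delta^8).  When theta <= t0, every non-discrepant arm whose sum
    is at least t0 is accepted if it is reached; such arms have frequency at least
    eta/8.  The number of second tests is thus at most 1 plus the number of
    discrepant arms preceded by no arm of this kind.  The latter events do not
    mention the random threshold, are independent across arms, and give a geometric
    series, so that O(1) second tests are expected.  Finally no arm of mean below
    G^-1(1 - eta) - eps passes its second test, by a union bound over the n arms. *)

Require Import Defs.
From HB Require Import structures.
From mathcomp Require Import all_boot all_order all_algebra.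
From mathcomp Require Import all_classical all_reals all_analysis.
From mathcomp Require Import measurable_realfun.
From mathcomp Require Import ring lra.
Set Implicit Arguments. Unset Strict Implicit. Unset Printing Implicit Defensive.
Import Order.TTheory GRing.Theory Num.Theory.
Local Open Scope classical_set_scope.
Local Open Scope ring_scope.
(** * Execution of a screen-and-test algorithm *)

Section FindIota.
Local Open Scope nat_scope.
Variables (n : nat) (P : pred nat).

Lemma find_iota_le : find P (iota 0 n) <= n.
Proof. by rewrite -[X in _ <= X](size_iota 0) find_size. Qed.

Lemma find_iota_true : find P (iota 0 n) < n -> P (find P (iota 0 n)).
Proof.
move=> lt; have := lt; rewrite -[X in _ < X](size_iota 0) -has_find => h.
by have := nth_find 0 h; rewrite nth_iota.
Qed.

Lemma find_iota_before i : i < find P (iota 0 n) -> P i = false.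
Proof.
move=> lt; have := before_find 0 lt.
by rewrite nth_iota// (leq_trans lt)// find_iota_le.
Qed.

Lemma find_iota_min i : i < n -> P i -> find P (iota 0 n) <= i.
Proof. by move=> _; case: leqP => // /find_iota_before ->. Qed.

Lemma find_iota_max j : j <= n -> (forall i, i < j -> ~~ P i) ->
  j <= find P (iota 0 n).
Proof.
move=> jn H; case: leqP => // lt.
by have := find_iota_true (leq_trans lt jn); rewrite (negbTE (H _ lt)).
Qed.

End FindIota.

Section ScreenAndTest.
Local Open Scope nat_scope.
Variables (R : realType) (n m1 m2 : nat).
Variables cand pass : (nat -> nat -> bool) -> nat -> bool.

(** A reward not yet seen reads as [false]. This filler never affects a decision: [cand] and [pass]
    are consulted only once the pulls they depend on have been made. *)
Definition observed (h : seq (nat * bool)) (i k : nat) : bool :=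
  nth false [seq ab.2 | ab <- h & ab.1 == i] k.

(* Arms below n that still lack screening pulls come first; afterwards [j] is the
   first candidate that is not fully tested or that passes. *)
Definition screen_and_test : algorithm R := fun _ h =>
  let i := find (fun i => nb_pulls h i < m1) (iota 0 n) in
  if i < n then Pull i else
  let x := observed h in
  let j := find (fun j => cand x j && ((nb_pulls h j < m1 + m2) || pass x j))
                (iota 0 n) in
  if j < n then if nb_pulls h j < m1 + m2 then Pull j else Stop (Some j)
  else Stop None.

Definition first_accepted x := find (fun i => cand x i && pass x i) (iota 0 n).

Definition accepted x := if first_accepted x < n then Some (first_accepted x)
                         else None.

(* An arm is tested iff it is a candidate not preceded by an accepted arm; since
   [find] returns [n] when nothing is found, this covers the no-acceptance case. *)
Definition tested x i := cand x i && (i <= first_accepted x).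

Definition pull_budget x := \sum_(i < n) (m1 + m2 * tested x i).

Hypothesis cand_local : forall x y i, i < n ->
  (forall j k, j < n -> k < m1 -> x j k = y j k) -> cand x i = cand y i.
Hypothesis pass_local : forall x y i, i < n ->
  (forall j k, j < n -> k < m1 -> x j k = y j k) ->
  (forall k, k < m1 + m2 -> x i k = y i k) -> pass x i = pass y i.

(** The invariant of the execution. Its last clause says that no arm outside the first [n] was
    pulled, and turns the per-arm budgets into a bound on the length of the history. *)
Definition consistent x h :=
  [/\ forall i k, k < nb_pulls h i -> observed h i k = x i k,
      forall i, i < n -> nb_pulls h i <= m1 + m2 * tested x i &
      size h = \sum_(i < n) nb_pulls h i].

Lemma nb_pulls_rcons h i b j : nb_pulls (rcons h (i, b)) j = nb_pulls h j + (i == j).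
Proof. by rewrite /nb_pulls -cats1 count_cat /= addn0. Qed.

Lemma observed_rcons h i j k x : k < nb_pulls (rcons h (i, x i (nb_pulls h i))) j ->
  (k < nb_pulls h j -> observed h j k = x j k) ->
  observed (rcons h (i, x i (nb_pulls h i))) j k = x j k.
Proof.
rewrite nb_pulls_rcons /observed -cats1 filter_cat map_cat nth_cat size_map size_filter.
rewrite -/(nb_pulls h j) => lt H; case: ltnP => [lt2|ge]; first exact: H.
move: lt; rewrite /=; case: eqP => [ij|_] /=; rewrite ?addn1 ?addn0 => lt; last first.
  by have := leq_trans lt ge; rewrite ltnn.
have /eqP-> : k == nb_pulls h j by rewrite eqn_leq ge -ltnS lt.
by rewrite subnn ij.
Qed.

(** After screening, candidacy read off the history is the true one, and so is the verdict on any
    fully tested arm. The scan therefore never passes the first accepted arm: what it pulls counts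
    as tested, and what it stops at is the first accepted arm. *)
Lemma screen_and_test_action x h u : consistent x h ->
  match screen_and_test u h with
  | Pull i => i < n /\ nb_pulls h i < m1 + m2 * tested x i
  | Stop o => o = accepted x
  end.
Proof.
case=> obs bud _; rewrite /screen_and_test.
set i := find _ _; case: ltnP => [lt|ge].
  by split=> //; apply: leq_trans (leq_addr _ _); apply: (find_iota_true lt).
have full j : j < n -> m1 <= nb_pulls h j.
  by move=> jn; rewrite leqNgt (find_iota_before (leq_trans jn ge)).
have agree j k : j < n -> k < m1 -> observed h j k = x j k.
  by move=> jn km; apply: obs; apply: leq_trans km (full _ jn).
have candE j : j < n -> cand (observed h) j = cand x j.
  by move=> jn; apply: cand_local.
have passE j : j < n -> m1 + m2 <= nb_pulls h j -> pass (observed h) j = pass x j.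
  by move=> jn ge2; apply: pass_local => // k km; apply/obs/(leq_trans km).
set j := find _ _.
(* A candidate skipped by the scan is fully tested and has failed, so it is not accepted. *)
have jle : j <= first_accepted x.
  apply: find_iota_max; first exact: find_iota_le.
  move=> l lj; have ln : l < n by apply: leq_trans lj (find_iota_le _ _).
  have := find_iota_before lj; rewrite candE//; case: (cand x l) => //=.
  by case: ltnP => //= ge2; rewrite passE// => ->.
case: ltnP => jn; last by rewrite /accepted ltnNge (leq_trans jn jle).
have /andP[] := find_iota_true jn; rewrite -/j candE// => cj.
case: ltnP => [lt2 _|ge2 /=].
  by split=> //; rewrite /tested cj jle muln1.
rewrite passE// => pj; have je : first_accepted x = j.
  by apply/eqP; rewrite eqn_leq jle andbT find_iota_min// cj.
by rewrite /accepted je jn.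
Qed.

(** Every step that leaves the execution running makes exactly one pull; the clause [size h = t]
    records this and is what forces termination. *)
Lemma exec_consistent x u t :
  match exec screen_and_test u x t with
  | Running h => consistent x h /\ size h = t
  | Done s o => s <= pull_budget x /\ o = accepted x
  end.
Proof.
have bsz h : consistent x h -> size h <= pull_budget x.
  by case=> _ bud ->; apply: leq_sum => i _; apply: bud.
elim: t => [|t IH].
  by split=> //; split=> //; rewrite big1.
rewrite /exec iterS -/(exec screen_and_test u x t).
case: (exec _ _ _ t) IH => //= h [ch sh].
have := @screen_and_test_action x h u ch.
case: (screen_and_test u h) => [i [iln bi]|o ->]; last by split=> //; apply: bsz.
split; last by rewrite size_rcons sh.
case: ch => obs bud sz; split.
- by move=> j k kj; apply: observed_rcons => // /obs.
- move=> j jn; rewrite nb_pulls_rcons; case: eqP => [<-|_]; rewrite ?addn1 ?addn0//.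
  exact: bud.
- rewrite size_rcons sz; under [RHS]eq_bigr do rewrite nb_pulls_rcons.
  rewrite big_split /= (_ : \sum_(j < n) (i == j) = 1) ?addn1//.
  rewrite (bigD1 (Ordinal iln))//= eqxx big1// => j /eqP jn.
  by case: eqP => // ij; case: jn; apply: val_inj.
Qed.

Lemma outputs_screen_and_test x u i :
  outputs screen_and_test u x i <-> accepted x = Some i.
Proof.
split=> [[t [s E]]|ai].
  by have := exec_consistent x u t; rewrite E => -[_ ->].
(* One step beyond the budget, a running state would hold more pulls than a consistent history
   allows. *)
have := exec_consistent x u (pull_budget x).+1.
case E: exec => [h|s o] [].
  case=> _ bud -> sz; have : \sum_(i < n) nb_pulls h i <= pull_budget x.
    by apply: leq_sum => j _; apply: bud.
  by rewrite sz ltnn.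
by rewrite ai => _ oE; exists (pull_budget x).+1, s; rewrite E oE.
Qed.

Lemma sample_complexity_screen_and_test x u :
  (sample_complexity screen_and_test u x <= ((pull_budget x)%:R%R : R)%:E)%E.
Proof.
apply: ub_ereal_sup => _ [t _ <-]; rewrite lee_fin ler_nat.
have := exec_consistent x u t; case: exec => /= [h|s o] []; last by [].
by case=> _ bud -> _; apply: leq_sum => i _; apply: bud.
Qed.

(** Together with the next lemma this reduces everything to a finite [n] by [m1 + m2] corner of the
    reward table, whose law is a finite product. *)
Lemma first_accepted_local x y :
  (forall j k, j < n -> k < m1 + m2 -> x j k = y j k) ->
  first_accepted x = first_accepted y.
Proof.
move=> H; have H1 j k : j < n -> k < m1 -> x j k = y j k.
  by move=> jn km; apply: H => //; apply: leq_trans km (leq_addr _ _).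
rewrite /first_accepted; apply: eq_in_find => i; rewrite mem_iota /= add0n => iln.
by rewrite (cand_local iln H1) (pass_local iln H1)// => k; apply: H.
Qed.

Lemma pull_budget_local x y :
  (forall j k, j < n -> k < m1 + m2 -> x j k = y j k) ->
  pull_budget x = pull_budget y.
Proof.
move=> H; rewrite /pull_budget; apply: eq_bigr => i _.
rewrite /tested (first_accepted_local H) (@cand_local x y)//.
by move=> j k jn km; apply: H => //; apply: leq_trans km (leq_addr _ _).
Qed.

End ScreenAndTest.

Lemma alg_measurable_det (R : realType) (A : algorithm R) :
  (forall u v h, A u h = A v h) -> alg_measurable A.
Proof.
move=> Adet h a; have [e|ne] := pselect (A 0 h = a).
  rewrite (_ : [set u | _] = setT)//; apply/seteqP; split=> // u _ /=.
  by rewrite (Adet u 0).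
rewrite (_ : [set u | _] = set0)//; apply/seteqP; split=> // u /=.
by rewrite (Adet u 0).
Qed.

(** * Finite product weights *)

Section ProductWeights.
Variable R : realType.

(** From exp(-x) >= 1 - x one gets exp(x) <= 1/(1 - x), and (1 - x)(1 + x + 2x^2) = 1 + x^2 (1 - 2x)
    >= 1. Negative x are allowed, so both tails follow from one inequality. *)
Lemma expR_le_quad (x : R) : x <= 2^-1 -> expR x <= 1 + (x + 2 * x ^+ 2).
Proof.
move=> x2; have e := expR_ge1Dx (- x); rewrite expRN in e.
have p : 0 < 1 - x by lra.
have : expR x <= (1 - x)^-1.
  by rewrite -[leLHS]invrK lef_pV2// posrE ?invr_gt0 ?expR_gt0.
move/le_trans; apply; rewrite -[leLHS]mul1r ler_pdivrMr//.
by nra.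
Qed.

Variables (I T : finType) (w : T -> R).
Hypothesis w_ge0 : forall x, 0 <= w x.
Hypothesis w_sum1 : \sum_x w x = 1.

(** Probability of an event under the mass function [w]; [prod_weight] is its i.i.d. version. Both
    serve at two levels: rewards within a row given the mean, and rows within a table. *)
Definition weight (phi : pred T) : R := \sum_(x | phi x) w x.

Definition prod_weight (Phi : pred {ffun I -> T}) : R :=
  \sum_(z | Phi z) \prod_i w (z i).

Lemma weight_ge0 phi : 0 <= weight phi.
Proof. exact: sumr_ge0. Qed.

Lemma weightC phi : weight (predC phi) = 1 - weight phi.
Proof. by apply/eqP; rewrite eq_sym subr_eq addrC -w_sum1 (bigID phi)//=. Qed.

Lemma prod_weight_le (Phi Psi : pred {ffun I -> T}) :
  subpred Phi Psi -> prod_weight Phi <= prod_weight Psi.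
Proof.
move=> sub; rewrite /prod_weight big_mkcond [leRHS]big_mkcond.
apply: ler_sum => x _; case: ifP => [/sub ->//|_]; case: ifP => // _.
exact: prodr_ge0.
Qed.

Lemma prod_weightU (Phi Psi : pred {ffun I -> T}) :
  prod_weight (fun z => Phi z || Psi z) <= prod_weight Phi + prod_weight Psi.
Proof.
rewrite /prod_weight !(big_mkcond (fun z => Phi z || Psi z)) (big_mkcond Phi) (big_mkcond Psi).
rewrite -big_split /=; apply: ler_sum => z _.
have := @prodr_ge0 R I (index_enum I) predT (fun i => w (z i)) (fun i _ => w_ge0 _).
by case: (Phi z); case: (Psi z) => /=; lra.
Qed.

Lemma prod_weight_forall (phi : I -> pred T) :
  prod_weight (fun z => [forall i, phi i (z i)]) = \prod_i weight (phi i).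
Proof.
rewrite /prod_weight /weight bigA_distr_big_dep; apply: eq_bigl => z.
by apply/forallP/familyP.
Qed.

Lemma prod_weightT : prod_weight predT = 1.
Proof.
transitivity (\prod_(i : I) weight predT); last by rewrite big1.
rewrite -prod_weight_forall; apply: eq_bigl => z.
by apply/esym/forallP.
Qed.

(* For negative [lam] this is a lower tail bound. *)
Lemma prod_weight_chernoff (A : pred I) (phi : pred T) (lam s : R) :
  lam <= 2^-1 ->
  prod_weight (fun z => lam * s <= lam * (\sum_(i | A i) phi (z i))%N%:R) <=
  expR (#|A|%:R * (weight phi * (lam + 2 * lam ^+ 2)) - lam * s).
Proof.
move=> lam2; set u := weight phi * _.
pose c (i : I) (x : T) := expR (lam * (A i && phi x)%:R).
have sumE z : lam * (\sum_(i | A i) phi (z i))%N%:R =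
    \sum_i lam * (A i && phi (z i))%:R.
  rewrite big_mkcond natr_sum mulr_sumr; apply: eq_bigr => i _.
  by case: (A i).
(* Markov's inequality for the exponential moment, which then factors over the coordinates; each
   factor is at most 1 + u <= exp(u) on [A] and 1 off [A]. *)
apply: (@le_trans _ _ (\sum_(z : {ffun I -> T}) expR (- (lam * s)) * \prod_i (w (z i) * c i (z i)))).
  rewrite /prod_weight big_mkcond; apply: ler_sum => z _.
  rewrite big_split /= mulrCA; case: ifPn => [le|_]; last first.
    by rewrite mulr_ge0 ?prodr_ge0// mulr_ge0 ?expR_ge0// prodr_ge0// => i _; exact: expR_ge0.
  rewrite ler_peMr ?prodr_ge0// /c -expR_sum -expRD -sumE.
  by rewrite -[leLHS]expR0 ler_expR addrC subr_ge0.
rewrite -mulr_sumr addrC expRD ler_wpM2l ?expR_ge0//.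
rewrite -(bigA_distr_bigA (fun i x => w x * c i x)).
rewrite expRM_natl -prodr_const [leRHS]big_mkcond.
apply: ler_prod => i _; apply/andP; split.
  by apply: sumr_ge0 => x _; rewrite mulr_ge0 ?expR_ge0.
rewrite unfold_in; case: ifPn => Ai; last first.
  rewrite -w_sum1; apply: ler_sum => x _.
  by rewrite /c (negbTE Ai) mulr0 expR0 mulr1.
apply: le_trans (expR_ge1Dx _); rewrite /u /weight mulr_suml -[X in _ <= X + _]w_sum1.
rewrite [X in _ + X]big_mkcond -big_split; apply: ler_sum => x _ /=.
rewrite /c Ai /=; case: (phi x) => /=; last by rewrite mulr0 expR0 addr0 mulr1.
rewrite mulr1; have := expR_le_quad lam2; move/(ler_wpM2l (w_ge0 x)).
by rewrite mulrDr mulr1.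
Qed.

End ProductWeights.

(** * The law of the reward table *)

Section IntegralIndep.
Local Open Scope ereal_scope.
Context d (Omega : measurableType d) (R : realType).
Variables (P : {measure set Omega -> \bar R}) (mu : {measure set R -> \bar R}).
Variables (G : Omega -> R) (Y : Omega -> R) (c : R).
Hypothesis G_ge0 : forall w, (0 <= G w)%R.
Hypothesis mG : measurable_fun setT G.
Hypothesis mY : measurable_fun setT Y.
Hypothesis c_ge0 : (0 <= c)%R.
Hypothesis law : forall B, measurable B ->
  \int[P]_(w in Y @^-1` B) (G w)%:E = c%:E * mu B.

Import HBNNSimple.

(** On each level set of [h] the claim is [law]; the finitely many values are summed. *)
Lemma integral_nnsfun_weighted (h : {nnsfun R >-> R}) :
  \int[P]_w ((h (Y w))%:E * (G w)%:E) = c%:E * \int[mu]_t (h t)%:E.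
Proof.
have mA r : measurable (Y @^-1` (h @^-1` [set r])).
  by rewrite -[X in measurable X]setTI; exact: mY.
have mI r : measurable_fun setT (fun w => \1_(h @^-1` [set r]) (Y w) : R).
  exact: measurableT_comp (measurable_indic _) mY.
have hE w : (h (Y w))%:E * (G w)%:E = \sum_(r \in range h)
    ((r * \1_(h @^-1` [set r]) (Y w))%:E * (G w)%:E).
  rewrite [in LHS]fimfunE -fsumEFin// ge0_mule_fsuml// => r.
  by rewrite EFinM nnfun_muleindic_ge0.
under eq_integral do rewrite hE.
rewrite ge0_integral_fsum//; last 2 first.
- move=> r; apply: emeasurable_funM; apply/measurable_EFinP => //.
  exact: measurable_funM.
- by move=> r w _; rewrite mule_ge0 ?lee_fin// -lee_fin EFinM nnfun_muleindic_ge0.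
under [in RHS]eq_integral do rewrite fimfunE -fsumEFin//.
rewrite ge0_integral_fsum//; last 2 first.
- by move=> r; apply/measurable_EFinP/measurable_funM.
- by move=> r w _; rewrite EFinM nnfun_muleindic_ge0.
rewrite ge0_mule_fsumr; last first.
  by move=> r; apply: integral_ge0 => t _; rewrite EFinM nnfun_muleindic_ge0.
apply: eq_fsbigr => r; rewrite inE => -[t _ rE].
have r0 : (0 <= r)%R by rewrite -rE.
rewrite integralZl_indic_nnsfun//= integral_indic// setIT muleCA -law//.
under eq_integral do rewrite EFinM -muleA.
rewrite ge0_integralZl//; last 2 first.
- apply: emeasurable_funM; apply/measurable_EFinP => //.
- by move=> w _; rewrite mule_ge0 ?lee_fin.
congr (_ * _); rewrite [RHS]integral_mkcond; apply: eq_integral => w _.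
by rewrite epatch_indic muleC.
Qed.

(** [law] says that the image under [Y] of the measure with density [G] is [c] times [mu]. The
    formula for simple functions extends by monotone convergence. It serves to integrate out one
    mean at a time, [G] being the product of the other factors. *)
Lemma integral_weighted (f : R -> R) :
  measurable_fun setT f -> (forall t, (0 <= f t)%R) ->
  \int[P]_w (f (Y w) * G w)%:E = c%:E * \int[mu]_t (f t)%:E.
Proof.
move=> mf f0; have mEf : measurable_fun setT (EFin \o f) by exact/measurable_EFinP.
pose h := nnsfun_approx measurableT mEf.
have hf t : (h k t)%:E @[k --> \oo] --> (f t)%:E.
  by apply: (@cvg_nnsfun_approx _ _ _ _ measurableT _ mEf) => // x _; rewrite lee_fin.
have nd k l t : (k <= l)%N -> (h k t <= h l t)%R.
  by move=> kl; exact/lefP/nd_nnsfun_approx.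
have -> : \int[mu]_t (f t)%:E = limn (fun k => \int[mu]_t (h k t)%:E).
  rewrite -monotone_convergence//=.
  - by apply: eq_integral => t _; apply/esym/cvg_lim.
  - by move=> k; apply/measurable_EFinP.
  - by move=> k t _; rewrite lee_fin.
  - by move=> t _ k l kl; rewrite lee_fin nd.
have -> : \int[P]_w (f (Y w) * G w)%:E =
    limn (fun k => \int[P]_w ((h k (Y w))%:E * (G w)%:E)).
  rewrite -monotone_convergence//=.
  - apply: eq_integral => w _; apply/esym/cvg_lim => //.
    by rewrite EFinM; apply: cvgeZr => //; exact: hf.
  - move=> k; apply: emeasurable_funM; apply/measurable_EFinP => //.
    exact: measurableT_comp.
  - by move=> k w _; rewrite mule_ge0 ?lee_fin.
  - by move=> w _ k l kl; rewrite lee_wpmul2r ?lee_fin ?nd.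
rewrite -limeMl//.
  by congr (limn _); apply/funext => k /=; rewrite integral_nnsfun_weighted.
apply/ereal_nondecreasing_is_cvgn => a b ab; apply: ge0_le_integral => //.
- by move=> x _; rewrite lee_fin.
- exact/measurable_EFinP.
- exact/measurable_EFinP.
- by move=> x _; rewrite lee_fin nd.
Qed.

End IntegralIndep.

(* Unlike [ge0_le_integral], no measurability is required. *)
Lemma ge0_le_integralT d (T : measurableType d) (R : realType)
    (mu : {measure set T -> \bar R}) (f g : T -> \bar R) :
  (forall x, 0 <= f x)%E -> (forall x, f x <= g x)%E ->
  (\int[mu]_x f x <= \int[mu]_x g x)%E.
Proof.
move=> f0 fg; rewrite !ge0_integralTE//; last by move=> x; apply: le_trans (fg x).
by apply: ereal_sup_le => _ [h /= hf <-]; exists h => // x; apply: le_trans (fg x).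
Qed.

Lemma probability_setI_full d (T : measurableType d) (R : realType)
    (P : probability T R) (A B : set T) :
  measurable A -> measurable B -> P B = 1%E -> P (A `&` B) = P A.
Proof.
move=> mA mB PB; transitivity (P (A `\` B) + P (A `&` B))%E; last by rewrite -measureDI.
suff -> : P (A `\` B) = 0%E by rewrite add0e.
apply/eqP; rewrite eq_le measure_ge0 andbT.
have -> : 0%E = P (~` B) by rewrite probability_setC// PB subee.
apply: le_measure; rewrite ?inE; [exact: measurableD|exact: measurableC|].
by move=> x [].
Qed.

Section FiniteValued.
Context d (Omega : measurableType d) (R : realType) (P : probability Omega R).
Variables (T : finType) (Z : Omega -> T).
Hypothesis mZ : forall x, measurable [set w | Z w = x].

Lemma measurable_finite_valued (phi : pred T) : measurable [set w | phi (Z w)].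
Proof.
rewrite (_ : [set w | _] = \bigcup_(x in [set x | phi x]) [set w | Z w = x]).
  by apply: fin_bigcup_measurable => // x _; exact: mZ.
apply/seteqP; split=> [w /= pw|w [x /= px ->//]]; by exists (Z w).
Qed.

Lemma measure_finite_valued (A : set Omega) (phi : pred T) : measurable A ->
  P [set w | A w /\ phi (Z w)] = \sum_(x | phi x) P [set w | A w /\ Z w = x].
Proof.
move=> mA; suff H s : uniq s -> P [set w | A w /\ Z w \in s] =
    \sum_(x <- s) P [set w | A w /\ Z w = x].
  rewrite -big_enum -H ?enum_uniq//; congr (P _); apply/seteqP; split => w /=;
  by rewrite mem_enum.
elim: s => [_|x s IH /= /andP[xs us]].
  rewrite big_nil (_ : [set w | _] = set0) ?measure0//.
  by apply/seteqP; split=> w //= [].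
have m1 : measurable [set w | A w /\ Z w = x] 
  by apply: measurableI => //; exact: mZ.
have m2 : measurable [set w | A w /\ Z w \in s].
  by apply: measurableI => //; apply: (measurable_finite_valued (mem s)).
rewrite big_cons -IH// -measureU//.
  congr (P _); apply/seteqP; split => w /=; rewrite ?inE.
    by case=> Aw /orP[/eqP|]; [left|right].
  by case=> [[Aw ->]|[Aw ->]]; rewrite ?eqxx ?orbT.
by apply/seteqP; split => w //= [[_ ->] [_]]; rewrite (negbTE xs).
Qed.

Lemma integral_finite_valued (f : T -> R) : (forall x, 0 <= f x) ->
  (\int[P]_w (f (Z w))%:E = \sum_x (f x)%:E * P [set w | Z w = x])%E.
Proof.
move=> f0.
have fE w : ((f (Z w))%:E = \sum_x (f x)%:E * (\1_[set w | Z w = x] w)%:E)%E.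
  rewrite (bigD1 (Z w))//= big1; last first.
    by move=> x xZ; rewrite indicE memNset ?mule0//= => e; rewrite e eqxx in xZ.
  by rewrite adde0 indicE mem_set//= mule1.
under eq_integral do rewrite fE.
rewrite ge0_integral_sum//; last 2 first.
- move=> x; apply: emeasurable_funM => //.
  by apply/measurable_EFinP; apply: measurable_indic; exact: mZ.
- by move=> x w _; rewrite mule_ge0 ?lee_fin.
apply: eq_bigr => x _; rewrite ge0_integralZl ?lee_fin//; last first.
- by apply/measurable_EFinP; apply: measurable_indic; exact: mZ.
by rewrite integral_indic// setIT.
Qed.

End FiniteValued.

Section BernoulliRows.
Variables (R : realType) (M : nat).

Definition row_lik (x : {ffun 'I_M -> bool}) (t : R) : R :=
  \prod_k bern t (x k).

Lemma bern_bounds (t : R) b : 0 <= t <= 1 -> 0 <= bern t b <= 1.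
Proof. by move=> /andP[t0 t1]; case: b => /=; apply/andP; split; lra. Qed.

Lemma bern_sum (t : R) : \sum_b bern t b = 1.
Proof. by rewrite big_bool /= addrC subrK. Qed.

Lemma row_lik_ge0 x (t : R) : 0 <= t <= 1 -> 0 <= row_lik x t.
Proof. by move=> t01; apply: prodr_ge0 => k _; have /andP[] := bern_bounds (x k) t01. Qed.

Lemma row_lik_le1 x (t : R) : 0 <= t <= 1 -> row_lik x t <= 1.
Proof.
move=> t01; rewrite -[leRHS](@big1 _ 1 *%R 'I_M (index_enum _) predT (fun=> 1))//.
by apply: ler_prod => k _; apply: bern_bounds.
Qed.

Lemma measurable_row_lik x : measurable_fun setT (row_lik x).
Proof.
apply: measurable_prod => k _; case: (x k) => /=; first exact: measurable_id.
by apply: measurable_funB => //; exact: measurable_id.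
Qed.

End BernoulliRows.

(** * Product form of the law of finitely many rewards *)

Section BanditLaw.
Context (R : realType) (mu : probability R R) (d : measure_display)
  (Omega : measurableType d) (P : probability Omega R) (p : nat -> Omega -> R)
  (X : nat -> nat -> Omega -> bool) (U : Omega -> R).
Hypothesis model : bandit_model mu P p X U.
Hypothesis mu01 : mu `[0, 1]%classic = 1%E.

Lemma measurable_mean i B : measurable B -> measurable [set w | B (p i w)].
Proof. by case: model => _ mp _ _ _ mB; rewrite -[X in measurable X]setTI; exact: mp. Qed.

Lemma measurable_means (F : seq nat) (B : nat -> set R) :
  (forall i, measurable (B i)) ->
  measurable [set w | forall i, i \in F -> B i (p i w)].
Proof.
move=> mB; rewrite (_ : [set w | _] = \bigcap_(i in [set` F]) [set w | B i (p i w)]).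
  by apply: fin_bigcap_measurable => // i _; exact: measurable_mean.
by apply/seteqP; split=> w /= H i; apply: H.
Qed.

Lemma means_law (F : seq nat) (B : nat -> set R) :
  uniq F -> (forall i, measurable (B i)) ->
  P [set w | forall i, i \in F -> B i (p i w)] = (\prod_(i <- F) fine (mu (B i)))%:E.
Proof.
move=> uF mB; case: model => _ _ _ /(_ F B setT uF measurableT mB) + _.
rewrite setTI lebesgue_measure_itv/= lte01 oppr0 adde0 mul1e => <-.
by congr (P _); apply/seteqP; split=> w /=; tauto.
Qed.

(** The model states independence of the means for events only; here it is upgraded to products of
    functions. Functions over [r] are mixed with events over [F] so that the induction can move an
    arm from [r] to [F]. *)
Lemma integral_prod_means (f : nat -> R -> R) :
  (forall i, measurable_fun setT (f i)) -> (forall i t, 0 <= f i t <= 1) ->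
  forall (r F : seq nat) (B : nat -> set R), uniq (r ++ F) ->
  (forall i, measurable (B i)) ->
  (\int[P]_(w in [set w | forall i, i \in F -> B i (p i w)])
     (\prod_(i <- r) f i (p i w))%:E =
   (\prod_(i <- r) fine (\int[mu]_t (f i t)%:E) * \prod_(i <- F) fine (mu (B i)))%:E)%E.
Proof.
move=> mf f01; have f0 i t : 0 <= f i t by have /andP[] := f01 i t.
have mp i : measurable_fun setT (p i) by case: model.
elim=> [|a r IH] F B /= u mB.
  under eq_integral do rewrite big_nil.
  rewrite big_nil mul1r integral_cst; last exact: measurable_means.
  by rewrite mul1e; exact: means_law.
case/andP: u => aN u.
have [ar aF] : a \notin r /\ a \notin F by move: aN; rewrite mem_cat negb_or => /andP[].
pose D := [set w | forall i, i \in F -> B i (p i w)].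
have mD : measurable D by exact: measurable_means.
pose G w := (\prod_(i <- r) f i (p i w)) * \1_D w.
have mG : measurable_fun setT G.
  apply: measurable_funM; last exact: measurable_indic.
  by apply: measurable_prod => i _; exact: measurableT_comp.
have I0 i : 0 <= fine (\int[mu]_t (f i t)%:E).
  by apply/fine_ge0/integral_ge0 => t _; rewrite lee_fin.
have Ifin i : (\int[mu]_t (f i t)%:E)%E \is a fin_num.
  rewrite ge0_fin_numE; last by apply: integral_ge0 => t _; rewrite lee_fin.
  apply: (@le_lt_trans _ _ (\int[mu]_t (cst 1%E t))%E); last first.
    rewrite integral_cst// mul1e; apply: (@le_lt_trans _ _ 1%E); last exact: ltry.
    exact: probability_le1.
  apply: ge0_le_integralT => t; rewrite lee_fin//.
  by have /andP[] := f01 i t.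
pose c := \prod_(i <- r) fine (\int[mu]_t (f i t)%:E) * \prod_(i <- F) fine (mu (B i)).
transitivity (\int[P]_w (f a (p a w) * G w)%:E)%E.
  rewrite integral_mkcond; apply: eq_integral => w _.
  by rewrite epatch_indic /= big_cons /G mulrA -EFinM.
rewrite (@integral_weighted _ _ _ P mu G (p a) c)//.
- by rewrite -[X in (c%:E * X)%E]fineK// -EFinM big_cons -mulrA [in LHS]mulrC.
- by move=> w; rewrite mulr_ge0 ?prodr_ge0.
(* The hypothesis of [integral_weighted] on the event [E] for arm [a] is the induction hypothesis
   with [a] added to [F] and constrained by [E]. *)
- move=> E mE; pose B' i := if i == a then E else B i.
  have mB' i : measurable (B' i) by rewrite /B'; case: ifP.
  have B'a : B' a = E by rewrite /B' eqxx.
  have BB i : i \in F -> B' i = B i.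
    by move=> iF; rewrite /B'; case: eqP => // e; rewrite e (negbTE aF) in iF.
  have u' : uniq (r ++ a :: F) by rewrite uniq_catC /= uniq_catC u mem_cat orbC -mem_cat aN.
  have := IH (a :: F) B' u' mB'; rewrite [X in (_ * X)%:E]big_cons B'a.
  rewrite [X in (_ * (_ * X))%:E](eq_big_seq (fun i => fine (mu (B i)))); last first.
    by move=> i /BB ->.
  rewrite mulrCA -/c [in _ * c]mulrC EFinM fineK ?fin_num_measure// => <-.
  rewrite [LHS]integral_mkcond [RHS]integral_mkcond.
  apply: eq_integral => w _; rewrite !epatch_indic /= /G -!EFinM -mulrA.
  congr ((_ * _)%:E); rewrite !indicE -natrM mulnb -in_setI; congr ((_ : bool)%:R).
  congr (w \in _); apply/seteqP; split => v /=.
    move=> [Dv Ev] i; rewrite inE => /orP[/eqP->|iF]; first by rewrite B'a.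
    by rewrite BB//; apply: Dv.
  move=> H; split.
    by move=> i iF; rewrite -BB//; apply: H; rewrite inE iF orbT.
  by have := H a; rewrite inE eqxx B'a; apply.
Qed.

Variables n M : nat.

Definition reward_row (i : nat) (w : Omega) : {ffun 'I_M -> bool} :=
  [ffun k : 'I_M => X i k w].

Definition reward_table (w : Omega) : {ffun 'I_n -> {ffun 'I_M -> bool}} :=
  [ffun i : 'I_n => reward_row i w].

(** The mixture over [mu] of the product Bernoulli laws. The indicator keeps the integrand in [0,1]
    at every real t, where [bern] itself may leave that range. *)
Definition row_weight (x : {ffun 'I_M -> bool}) : R :=
  fine (\int[mu]_t (row_lik x t * \1_(`[0, 1]%classic : set R) t)%:E)%E.

Lemma measurable_reward i k b : measurable [set w | X i k w = b].
Proof.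
have mX : measurable [set w | X i k w] by case: model.
case: b => //; rewrite (_ : [set w | _] = ~` [set w | X i k w]).
  exact: measurableC.
by apply/seteqP; split=> w /=; case: (X i k w).
Qed.

Lemma measurable_row i x : measurable [set w | reward_row i w = x].
Proof.
rewrite (_ : [set w | _] = \bigcap_(k in [set: 'I_M]) [set w | X i k w = x k]).
  by apply: fin_bigcap_measurable => // k _; exact: measurable_reward.
apply/seteqP; split=> w /= H.
  by move=> k _; rewrite -H ffunE.
by apply/ffunP => k; rewrite ffunE; apply: H.
Qed.

Lemma measurable_table z : measurable [set w | reward_table w = z].
Proof.
rewrite (_ : [set w | _] = \bigcap_(i in [set: 'I_n]) [set w | reward_row i w = z i]).
  by apply: fin_bigcap_measurable => // k _; exact: measurable_row.
apply/seteqP; split=> w /= H.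
  by move=> k _; rewrite -H ffunE.
by apply/ffunP => k; rewrite ffunE; apply: H.
Qed.

(** The model gives the probability of one table as the integral of its likelihood, a product over
    arms of functions of one mean each. Independence of the means then factors the integral. *)
Lemma table_fiber z :
  P [set w | reward_table w = z] = (\prod_i row_weight (z i))%:E.
Proof.
pose I01 : set R := `[0, 1]%classic.
have mI : measurable I01 by exact: measurable_itv.
pose F := [seq val i | i <- enum 'I_n].
have uF : uniq F by rewrite map_inj_uniq ?enum_uniq//; exact: val_inj.
have memF (i : 'I_n) : val i \in F by rewrite map_f// mem_enum.
pose K := [seq (val i, val k) | i <- enum 'I_n, k <- enum 'I_M].
have uK : uniq K.
  apply: allpairs_uniq; rewrite ?enum_uniq// => -[i k] [j l] _ _ /= [ij kl].
  by congr (_, _); exact: val_inj.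
pose b (ik : nat * nat) := if (insub ik.1, insub ik.2) is (Some i, Some k)
  then z i k else false.
have bE (i : 'I_n) (k : 'I_M) : b (val i, val k) = z i k by rewrite /b /= !valK.
(* Intersecting with this event of probability one supplies the indicators that occur in
   [row_weight]. *)
pose D := [set w | forall i, i \in F -> I01 (p i w)].
have mD : measurable D by apply: (@measurable_means F (fun=> I01)).
have PD : P D = 1%E.
  rewrite /D (@means_law F (fun=> I01))// big1// => i _.
  by rewrite /I01 mu01.
rewrite -(probability_setI_full (measurable_table z) mD PD).
case: model => _ _ _ _ /(_ F (fun=> I01) setT K b uF uK measurableT (fun=> mI)).
set A := [set w | _ /\ _]; set D' := [set w | setT _ /\ _] => law.
have D'E : D' = D by apply/seteqP; split=> w /=; rewrite /D' /D /=; tauto.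
have -> : [set w | reward_table w = z] `&` D = A.
  apply/seteqP; split=> w /=.
    move=> [zE Dw]; split; first by split.
    by move=> ik /allpairsP[[i k] [_ _ ->]] /=; rewrite bE -zE !ffunE.
  move=> [[_ Dw] H]; split=> //; apply/ffunP => i; apply/ffunP => k.
  rewrite !ffunE -bE -[LHS]/(X (val i, val k).1 (val i, val k).2 w) H//.
  by apply: allpairs_f; rewrite mem_enum.
rewrite law D'E.
pose f (i : nat) (t : R) :=
  if insub i is Some i' then row_lik (z i') t * \1_I01 t else 1.
have fE (i : 'I_n) t : f (val i) t = row_lik (z i) t * \1_I01 t by rewrite /f valK.
have I01P t : I01 t -> 0 <= t <= 1 by rewrite /I01 /= in_itv.
have mf i : measurable_fun setT (f i).
  rewrite /f; case: insub => [i'|]; last exact: measurable_cst.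
  by apply: measurable_funM; [exact: measurable_row_lik|exact: measurable_indic].
have f01 i t : 0 <= f i t <= 1.
  rewrite /f; case: insub => [i'|]; last by rewrite ler01 lexx.
  rewrite indicE; case: (asboolP (I01 t)) => It; last first.
    by rewrite memNset// mulr0 lexx ler01.
  by rewrite mem_set// mulr1 row_lik_ge0 ?row_lik_le1 ?I01P.
have uF0 : uniq (F ++ [::]) by rewrite cats0.
have := integral_prod_means mf f01 uF0 (fun=> measurableT).
rewrite [X in (_ * X)%:E]big_nil mulr1 [in RHS]big_map big_enum /=.
rewrite (_ : [set w | _] = setT); last by apply/seteqP; split.
under [in X in _ = X%:E -> _]eq_bigr do under eq_integral do rewrite fE.
move=> <-; rewrite integral_mkcond; apply: eq_integral => w _.
rewrite epatch_indic /= -EFinM; congr (_%:E).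
rewrite big_allpairs_dep [RHS]big_map [RHS]big_enum big_enum /=.
case: (asboolP (D w)) => Dw; last first.
  rewrite indicE memNset// mulr0; have /existsNP[i] := Dw.
  move/not_implyP => [/mapP[j _ ->]] nI.
  by rewrite (bigD1 j)//= fE indicE memNset// mulr0 mul0r.
rewrite indicE mem_set// mulr1; apply: eq_bigr => i _.
rewrite fE indicE mem_set; last by apply: Dw; exact: memF.
by rewrite mulr1 big_enum; apply: eq_bigr => k _; rewrite bE.
Qed.

Lemma table_law (Phi : pred {ffun 'I_n -> {ffun 'I_M -> bool}}) :
  P [set w | Phi (reward_table w)] = (prod_weight row_weight Phi)%:E.
Proof.
transitivity (P [set w | setT w /\ Phi (reward_table w)]).
  by congr (P _); apply/seteqP; split => w /=; tauto.
rewrite (measure_finite_valued _ measurable_table)// -sumEFin.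
apply: eq_bigr => z _; rewrite -table_fiber; congr (P _).
by apply/seteqP; split => w /=; tauto.
Qed.

Lemma row_weight_ge0 x : 0 <= row_weight x.
Proof.
apply/fine_ge0/integral_ge0 => t _; rewrite lee_fin indicE.
case: (asboolP ((`[0, 1]%classic : set R) t)) => It; last by rewrite memNset// mulr0.
by rewrite mem_set// mulr1; apply: row_lik_ge0; move: It; rewrite /= in_itv.
Qed.

Lemma integral_table (f : {ffun 'I_n -> {ffun 'I_M -> bool}} -> R) :
  (forall z, 0 <= f z) ->
  (\int[P]_w (f (reward_table w))%:E =
   (\sum_z f z * \prod_i row_weight (z i))%:E)%E.
Proof.
move=> f0; rewrite (integral_finite_valued _ measurable_table)// -sumEFin.
by apply: eq_bigr => z _; rewrite table_fiber.
Qed.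

(** Given its mean t, arm [i] returns independent Bernoulli(t) rewards, so a bound uniform over t in
    [B] integrates to the same bound. Unlike [table_law], this keeps the hidden mean inside the
    event. *)
Lemma arm_event_le i (B : set R) (phi : pred {ffun 'I_M -> bool}) (c : R) :
  measurable B -> 0 <= c ->
  (forall t, B t -> 0 <= t <= 1 -> prod_weight (bern t) phi <= c) ->
  (P [set w | B (p i w) /\ phi (reward_row i w)] <= c%:E)%E.
Proof.
move=> mB c0 H; pose I01 : set R := `[0, 1]%classic.
have mI : measurable I01 by exact: measurable_itv.
pose D := [set w | I01 (p i w)].
have mD : measurable D by exact: measurable_mean.
have PD : P D = 1%E.
  have := @means_law [:: i] (fun=> I01) erefl (fun=> mI).
  rewrite big_seq1 [mu I01]mu01 /= => <-; congr (P _).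
  apply/seteqP; split=> w /= Hw; last by apply: Hw; rewrite inE.
  by move=> j; rewrite inE => /eqP ->.
pose C := [set w | (B `&` I01) (p i w)].
have mC : measurable C by apply: measurable_mean; exact: measurableI.
have mS : measurable [set w | B (p i w) /\ phi (reward_row i w)].
  apply: measurableI; first exact: measurable_mean.
  exact: measurable_finite_valued (measurable_row i) phi.
rewrite -(probability_setI_full mS mD PD).
have -> : [set w | B (p i w) /\ phi (reward_row i w)] `&` D =
    [set w | C w /\ phi (reward_row i w)].
  by apply/seteqP; split => w /=; rewrite /C /D /=; tauto.
rewrite (measure_finite_valued P (measurable_row i) _ mC).
have rowE x : P [set w | C w /\ reward_row i w = x] =
    (\int[P]_(w in C) (row_lik x (p i w))%:E)%E.
  pose K := [seq (i, val k) | k <- enum 'I_M].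
  have uK : uniq K.
    by rewrite map_inj_uniq ?enum_uniq// => k l [] /val_inj.
  pose b (ik : nat * nat) := if insub ik.2 is Some k then x k else false.
  have bE (k : 'I_M) : b (i, val k) = x k by rewrite /b /= valK.
  case: model => _ _ _ _ /(_ [:: i] (fun=> B `&` I01) setT K b erefl uK measurableT).
  move=> /(_ (fun=> measurableI _ _ mB mI)).
  set A := [set w | _ /\ _]; set D' := [set w | setT _ /\ _] => law.
  have D'E : D' = C.
    apply/seteqP; split=> w; rewrite /D' /C.
      by move=> [_ /(_ i)]; rewrite inE; apply.
    by move=> Cw; split=> // j; rewrite inE => /eqP ->.
  have -> : [set w | C w /\ reward_row i w = x] = A.
    have -> : A = [set w | D' w /\ forall ik, ik \in K -> X ik.1 ik.2 w = b ik] by [].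
    rewrite D'E; apply/seteqP; split=> w /= [Cw Hw]; split=> //.
      by move=> ik /mapP[k _ ->] /=; rewrite bE -Hw ffunE.
    apply/ffunP => k; rewrite ffunE -bE -[LHS]/(X (i, val k).1 (i, val k).2 w) Hw//.
    by apply: map_f; rewrite mem_enum.
  rewrite law D'E; apply: eq_integral => w _; congr (_%:E).
  by rewrite big_map big_enum /=; apply: eq_bigr => k _; rewrite bE.
under eq_bigr do rewrite rowE.
have mL x : measurable_fun C (fun w => (row_lik x (p i w))%:E).
  apply/measurable_EFinP/measurable_funTS.
  apply: measurableT_comp; first exact: measurable_row_lik.
  by case: model.
have CP w : C w -> 0 <= p i w <= 1 by case=> _; rewrite /I01 /= in_itv.
rewrite -big_enum -ge0_integral_sum//; last first.
  by move=> x w Cw; rewrite lee_fin row_lik_ge0// CP.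
apply: (@le_trans _ _ (\int[P]_(w in C) cst c%:E w)%E).
  apply: ge0_le_integral => //.
  - by move=> w Cw; apply: sume_ge0 => x _; rewrite lee_fin row_lik_ge0// CP.
  - exact: emeasurable_sum.
  move=> w Cw; rewrite big_enum sumEFin lee_fin; apply: H; last exact: CP.
  by case: Cw.
rewrite integral_cst// -[leRHS]mule1 lee_wpmul2l ?lee_fin//.
exact: probability_le1.
Qed.

End BanditLaw.

(** * Threshold and acceptance *)

Section Threshold.
Variables (R : realType) (n m1 m2 : nat) (kappa e : R).

(** Screening and test sums both range over the whole row, restricted by a condition, so that one
    row carries both phases and the Chernoff bound applies with [A] the relevant block. *)
Definition screen_sum (x : nat -> nat -> bool) (i : nat) : nat :=
  \sum_(k < m1 + m2 | (k < m1)%N) x i k.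

Definition test_sum (x : nat -> nat -> bool) (i : nat) : nat :=
  \sum_(k < m1 + m2 | ~~ (k < m1)%N) x i k.

Definition nb_above x t : nat := \sum_(i < n) (t <= screen_sum x i)%N.

(** The empirical upper quantile: the highest level reached by at least [kappa] arms. Sums never
    exceed [m1], hence the range; an empty maximum is 0. *)
Definition threshold x : nat :=
  \max_(t < m1.+1 | kappa <= (nb_above x t)%:R) t.

Definition candidate x i : bool := (threshold x <= screen_sum x i)%N.

Definition passes x i : bool :=
  (threshold x)%:R / m1%:R - 2 * e <= (test_sum x i)%:R / m2%:R.

(** One-sided: only a drop from the screening average to the test average can make a candidate fail.
    The margin allows an error [e] in each phase. *)
Definition discrepant x i : bool :=
  2 * e < (screen_sum x i)%:R / m1%:R - (test_sum x i)%:R / m2%:R.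

Lemma screen_sum_local x y i :
  (forall k, (k < m1)%N -> x i k = y i k) -> screen_sum x i = screen_sum y i.
Proof. by move=> H; apply: eq_bigr => k km; rewrite H. Qed.

Lemma threshold_local x y :
  (forall j k, (j < n)%N -> (k < m1)%N -> x j k = y j k) -> threshold x = threshold y.
Proof.
move=> H; rewrite /threshold; apply: eq_bigl => t; rewrite /nb_above.
congr (_ <= _%:R); apply: eq_bigr => i _.
by rewrite (@screen_sum_local x y)// => k; apply: H.
Qed.

Lemma candidate_local x y i : (i < n)%N ->
  (forall j k, (j < n)%N -> (k < m1)%N -> x j k = y j k) ->
  candidate x i = candidate y i.
Proof.
move=> iln H; rewrite /candidate (threshold_local H) (@screen_sum_local x y)//.
by move=> k; apply: H.
Qed.

Lemma passes_local x y i : (i < n)%N ->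
  (forall j k, (j < n)%N -> (k < m1)%N -> x j k = y j k) ->
  (forall k, (k < m1 + m2)%N -> x i k = y i k) ->
  passes x i = passes y i.
Proof.
move=> iln H1 H2; rewrite /passes (threshold_local H1).
by congr (_ <= _%:R / _); apply: eq_bigr => k _; rewrite H2.
Qed.

Lemma card_ord_lt (N i : nat) : (i <= N)%N -> #|[pred j : 'I_N | (j < i)%N]| = i.
Proof. by move=> iN; rewrite -sum1_card (big_ord_narrow iN) sum1_card card_ord. Qed.

Lemma screen_sum_le x i : (screen_sum x i <= m1)%N.
Proof.
rewrite -[leqRHS](@card_ord_lt (m1 + m2))// ?leq_addr// -sum1_card.
by apply: leq_sum => k _; case: (x i k).
Qed.

Lemma threshold_le x t : (nb_above x t.+1)%:R < kappa -> (threshold x <= t)%N.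
Proof.
move=> lt; apply/bigmax_leqP => s ks; rewrite leqNgt; apply/negP => ts.
have : (nb_above x s <= nb_above x t.+1)%N.
  apply: leq_sum => i _; case: (leqP s) => // si.
  by rewrite (leq_trans ts si).
by rewrite -(ler_nat R) => le; move: (lt_le_trans lt ks); rewrite ltNge le.
Qed.

Lemma threshold_ge x (a : R) : 0 < kappa ->
  kappa <= (\sum_(i < n) ((a <= (screen_sum x i)%:R)%R : bool))%N%:R ->
  a <= (threshold x)%:R.
Proof.
move=> k0 kle.
have [/existsP[i0 ai0]|] := boolP [exists i : 'I_n, a <= (screen_sum x i)%:R]; last first.
  move=> /existsPn no; move: kle; rewrite big1; first by rewrite leNgt k0.
  by move=> i _; rewrite (negbTE (no i)).
(* The smallest sum that is at least [a] is an integer level reached by all the arms counted, so it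
   competes in the maximum. *)
case: (@arg_minnP _ i0 (fun i : 'I_n => a <= (screen_sum x i)%:R) (screen_sum x) ai0) => i ai imin.
apply: (le_trans ai); rewrite ler_nat.
have lt : (screen_sum x i < m1.+1)%N by rewrite ltnS screen_sum_le.
apply: (leq_bigmax_cond (Ordinal lt) (F := fun t : 'I_m1.+1 => nat_of_ord t)) => /=.
apply: (le_trans kle); rewrite ler_nat; apply: leq_sum => j _.
by have [aj|//] := boolP (a <= _); rewrite imin.
Qed.

Lemma candidate_fails_discrepant x i :
  candidate x i -> ~~ passes x i -> discrepant x i.
Proof.
rewrite /candidate /passes -ltNge /discrepant => c lt.
have : (threshold x)%:R / m1%:R <= (screen_sum x i)%:R / m1%:R :> R.
  by rewrite ler_wpM2r ?invr_ge0// ler_nat.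
by move: lt; lra.
Qed.

Lemma above_threshold_accepted x i t : (threshold x <= t)%N ->
  (t <= screen_sum x i)%N -> ~~ discrepant x i -> candidate x i && passes x i.
Proof.
move=> th ts; rewrite /discrepant -leNgt => nd.
have c : candidate x i by exact: leq_trans ts.
rewrite c /passes /=.
have : (threshold x)%:R / m1%:R <= (screen_sum x i)%:R / m1%:R :> R.
  by rewrite ler_wpM2r ?invr_ge0// ler_nat.
by move: nd; lra.
Qed.

(** With [t] fixed in place of the random threshold, this depends on the row of arm [i] alone and is
    thus independent across arms. *)
Definition sure_accept t x i : bool := (t <= screen_sum x i)%N && ~~ discrepant x i.

(** The leading 1 pays for the first accepted arm. Any other tested arm precedes it, so it is a
    failed candidate, hence discrepant, and no surely accepted arm comes before it. *)
Lemma nb_tested_le x t : (threshold x <= t)%N ->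
  (\sum_(i < n) tested n candidate passes x i <=
   1 + \sum_(i < n) ([forall j : 'I_n, (j < i)%N ==> ~~ sure_accept t x j] &&
                     discrepant x i))%N.
Proof.
move=> th; set fa := first_accepted n candidate passes x.
have : (\sum_(i < n) (i == fa :> nat) <= 1)%N.
  have [fan|fan] := ltnP fa n; last first.
    by rewrite big1// => i _; case: eqP => // ifa; have := ltn_ord i; rewrite ifa ltnNge fan.
  rewrite (bigD1 (Ordinal fan))//= eqxx big1// => i /eqP ni.
  by case: eqP => // ifa; case: ni; apply: val_inj.
rewrite -(leq_add2r (\sum_(i < n) ([forall j : 'I_n, (j < i)%N ==> ~~ sure_accept t x j] &&
                     discrepant x i))%N); apply: leq_trans.
rewrite -big_split /=; apply: leq_sum => i _; rewrite /tested -/fa.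
have [c|//] := boolP (candidate x i).
case: (leqP i fa) => //= ifa.
have [_|nfa] := eqVneq (nat_of_ord i) fa; first by [].
have lt : (i < fa)%N by rewrite ltn_neqAle nfa.
have := find_iota_before lt; rewrite c /= => np.
rewrite (candidate_fails_discrepant c) ?np// andbT.
rewrite (_ : [forall j, _] = true)//; apply/forallP => j; apply/implyP => ji.
apply/negP => /andP[tj dj].
by have := find_iota_before (ltn_trans ji lt); rewrite (above_threshold_accepted th).
Qed.

End Threshold.

(** * Tail bounds and the expected number of tests *)

Section BernoulliTails.
Variables (R : realType) (N : nat) (A : pred 'I_N) (t e : R).
Hypotheses (t01 : 0 <= t <= 1) (e02 : 0 < e <= 2).

Let bern0 b : 0 <= bern t b. Proof. by have /andP[] := bern_bounds b t01. Qed.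

Let weight_id : weight (bern t) id = t.
Proof. by rewrite /weight big_mkcond big_bool /= addr0. Qed.

Lemma bern_upper_tail :
  prod_weight (bern t) (fun x => (t + e) * #|A|%:R <= (\sum_(k | A k) x k)%N%:R) <=
  expR (- (#|A|%:R * e ^+ 2 / 8)).
Proof.
case/andP: (e02) => e0 e2; case/andP: (t01) => t0 t1.
(* The tilt e/4 minimises 2 lam^2 - lam e, with value -e^2/8; [e <= 2] makes it admissible. *)
have l2 : e / 4 <= 2^-1 :> R by lra.
apply: le_trans (le_trans (prod_weight_chernoff bern0 (bern_sum t) A id
  ((t + e) * #|A|%:R) l2) _).
  by apply: prod_weight_le => // x H; rewrite ler_wpM2l//; lra.
rewrite weight_id ler_expR; have A0 : 0 <= #|A|%:R :> R by [].
have h : t * (e / 4 + 2 * (e / 4) ^+ 2) - e / 4 * (t + e) <= - (e ^+ 2 / 8) by nra.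
by have := ler_wpM2l A0 h; lra.
Qed.

Lemma bern_lower_tail :
  prod_weight (bern t) (fun x => (\sum_(k | A k) x k)%N%:R <= (t - e) * #|A|%:R) <=
  expR (- (#|A|%:R * e ^+ 2 / 8)).
Proof.
case/andP: (e02) => e0 e2; case/andP: (t01) => t0 t1.
have l2 : - (e / 4) <= 2^-1 :> R by lra.
apply: le_trans (le_trans (prod_weight_chernoff bern0 (bern_sum t) A id
  ((t - e) * #|A|%:R) l2) _).
  by apply: prod_weight_le => // x H; rewrite !mulNr lerN2 ler_wpM2l//; lra.
rewrite weight_id ler_expR; have A0 : 0 <= #|A|%:R :> R by [].
have h : t * (- (e / 4) + 2 * (- (e / 4)) ^+ 2) - - (e / 4) * (t - e) <=
  - (e ^+ 2 / 8) by nra.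
by have := ler_wpM2l A0 h; lra.
Qed.

End BernoulliTails.

(** Pads a finite table with [false], so that the algorithm's decisions become functions of a
    finite-valued variable. *)
Definition extend n M (z : {ffun 'I_n -> {ffun 'I_M -> bool}}) (i k : nat) : bool :=
  if (insub i, insub k) is (Some i', Some k') then z i' k' else false.

Lemma extendE n M (z : {ffun 'I_n -> {ffun 'I_M -> bool}}) (i : 'I_n) (k : 'I_M) :
  extend z i k = z i k.
Proof. by rewrite /extend !valK. Qed.

Section Rows.
Variables (R : realType) (m1 m2 : nat) (e : R).
Hypotheses (m1_gt0 : (0 < m1)%N) (m2_gt0 : (0 < m2)%N) (e02 : 0 < e <= 2).
Implicit Type r : {ffun 'I_(m1 + m2) -> bool}.

Definition row_screen r : nat := \sum_(k : 'I_(m1 + m2) | (k < m1)%N) r k.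
Definition row_test r : nat := \sum_(k : 'I_(m1 + m2) | ~~ (k < m1)%N) r k.
Definition row_discrepant r : bool :=
  2 * e < (row_screen r)%:R / m1%:R - (row_test r)%:R / m2%:R.

Lemma screen_sum_extend n (z : {ffun 'I_n -> {ffun 'I_(m1 + m2) -> bool}}) (i : 'I_n) :
  screen_sum m1 m2 (extend z) i = row_screen (z i).
Proof. by apply: eq_bigr => k _; rewrite extendE. Qed.

Lemma test_sum_extend n (z : {ffun 'I_n -> {ffun 'I_(m1 + m2) -> bool}}) (i : 'I_n) :
  test_sum m1 m2 (extend z) i = row_test (z i).
Proof. by apply: eq_bigr => k _; rewrite extendE. Qed.

Lemma discrepant_extend n (z : {ffun 'I_n -> {ffun 'I_(m1 + m2) -> bool}}) (i : 'I_n) :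
  discrepant m1 m2 e (extend z) i = row_discrepant (z i).
Proof. by rewrite /discrepant screen_sum_extend test_sum_extend. Qed.

Lemma card_screen : #|[pred k : 'I_(m1 + m2) | (k < m1)%N]| = m1.
Proof. by rewrite card_ord_lt// leq_addr. Qed.

Lemma card_test : #|[pred k : 'I_(m1 + m2) | ~~ (k < m1)%N]| = m2.
Proof.
have := cardC [pred k : 'I_(m1 + m2) | (k < m1)%N].
by rewrite card_ord card_screen => /addnI.
Qed.

Lemma row_screen_upper_tail (t : R) : 0 <= t <= 1 ->
  prod_weight (bern t) (fun r => (t + e) * m1%:R <= (row_screen r)%:R) <=
  expR (- (m1%:R * e ^+ 2 / 8)).
Proof. by move=> t01; have := bern_upper_tail [pred k : 'I_(m1 + m2) | (k < m1)%N] t01 e02;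
  rewrite card_screen. Qed.

Lemma row_screen_lower_tail (t : R) : 0 <= t <= 1 ->
  prod_weight (bern t) (fun r => (row_screen r)%:R <= (t - e) * m1%:R) <=
  expR (- (m1%:R * e ^+ 2 / 8)).
Proof. by move=> t01; have := bern_lower_tail [pred k : 'I_(m1 + m2) | (k < m1)%N] t01 e02;
  rewrite card_screen. Qed.

Lemma row_test_upper_tail (t : R) : 0 <= t <= 1 ->
  prod_weight (bern t) (fun r => (t + e) * m2%:R <= (row_test r)%:R) <=
  expR (- (m2%:R * e ^+ 2 / 8)).
Proof. by move=> t01; have := bern_upper_tail [pred k : 'I_(m1 + m2) | ~~ (k < m1)%N] t01 e02;
  rewrite card_test. Qed.

Lemma row_test_lower_tail (t : R) : 0 <= t <= 1 ->
  prod_weight (bern t) (fun r => (row_test r)%:R <= (t - e) * m2%:R) <=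
  expR (- (m2%:R * e ^+ 2 / 8)).
Proof. by move=> t01; have := bern_lower_tail [pred k : 'I_(m1 + m2) | ~~ (k < m1)%N] t01 e02;
  rewrite card_test. Qed.

(** A drop above 2e requires the screening average to reach t + e or the test average to fall to t -
    e. The bound is free of t and so survives mixing over [mu]. *)
Lemma row_discrepant_tail (t : R) : 0 <= t <= 1 ->
  prod_weight (bern t) row_discrepant <=
  expR (- (m1%:R * e ^+ 2 / 8)) + expR (- (m2%:R * e ^+ 2 / 8)).
Proof.
move=> t01; apply: le_trans (lerD (row_screen_upper_tail t01) (row_test_lower_tail t01)).
have b0 b : 0 <= bern t b by have /andP[] := bern_bounds b t01.
apply: le_trans (prod_weightU b0 _ _); apply: prod_weight_le => // r.
rewrite /row_discrepant => dr; apply/negPn/negP; rewrite negb_or -!ltNge => /andP[].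
rewrite -ltr_pdivrMr ?ltr0n// => h1; rewrite -ltr_pdivlMr ?ltr0n// => h2.
by move: dr; lra.
Qed.

End Rows.

Lemma geometric_sum_le (R : realType) (c : R) n : 0 <= c <= 1 ->
  (1 - c) * \sum_(i < n) c ^+ i <= 1.
Proof.
move=> /andP[c0 c1]; suff -> : (1 - c) * \sum_(i < n) c ^+ i = 1 - c ^+ n.
  by rewrite gerBl exprn_ge0.
elim: n => [|n IH]; first by rewrite big_ord0 mulr0 expr0 subrr.
by rewrite big_ord_recr /= mulrDr IH exprS; ring.
Qed.

Lemma last_true (Q : pred nat) N : Q 0%N -> ~~ Q N -> exists2 t, Q t & ~~ Q t.+1.
Proof.
move=> Q0; elim: N => [/negP//|N IH QN].
by have [QN'|/IH] := boolP (Q N); first by exists N.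
Qed.

(** * Concentration of the threshold and the expected number of tests *)

Section FiniteAnalysis.
Variables (R : realType) (n m1 m2 : nat) (eta e a : R).
Local Notation row := {ffun 'I_(m1 + m2) -> bool}.
Variable w : row -> R.
Hypotheses (w_ge0 : forall r, 0 <= w r) (w_sum1 : \sum_r w r = 1).
Hypotheses (n_gt0 : (0 < n)%N) (eta01 : 0 < eta <= 1).
Hypothesis rare_discrepant : weight w (row_discrepant e) <= eta / 16.
Hypothesis often_above : 7 / 8 * eta <= weight w (fun r => a <= (row_screen r)%:R).

(** Separated by constant factors from the expected numbers of arms above [t0] (less than eta n/4)
    and at or above [a] (at least 7 eta n/8), so each deviation has probability exponentially small
    in eta n. *)
Let kappa : R := eta * n%:R / 2.
Let theta (z : {ffun 'I_n -> row}) := threshold n m1 m2 kappa (extend z).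
Let eta0 : 0 < eta. Proof. by case/andP: eta01. Qed.
Let n0 : 0 < n%:R :> R. Proof. by rewrite ltr0n. Qed.
Let kappa0 : 0 < kappa. Proof. by rewrite /kappa divr_gt0// mulr_gt0. Qed.

Definition row_sure t (r : row) : bool := (t <= row_screen r)%N && ~~ row_discrepant e r.

Lemma sure_accept_extend t (z : {ffun 'I_n -> row}) (i : 'I_n) :
  sure_accept m1 m2 e t (extend z) i = row_sure t (z i).
Proof. by rewrite /sure_accept screen_sum_extend discrepant_extend. Qed.

Lemma threshold_low_prob :
  prod_weight w (fun z => (theta z)%:R < a) <= expR (- (eta * n%:R / 64)).
Proof.
pose phi (r : row) := a <= (row_screen r)%:R.
(* This tilt gives, per arm, the exponent -(3/32)(7/8) eta + eta/16 = -5 eta/256, below -eta/64. *)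
have l2 : - (1 / 8) <= 2^-1 :> R by lra.
apply: le_trans (le_trans (prod_weight_chernoff w_ge0 w_sum1 predT phi kappa l2) _).
  apply: prod_weight_le => // z lt.
  rewrite !mulNr lerN2 ler_wpM2l//; apply: ltW; rewrite ltNge; apply/negP => le.
  move: lt; rewrite ltNge => /negP; apply; apply: threshold_ge => //.
  apply: (le_trans le); rewrite ler_nat; apply: leq_sum => i _.
  by rewrite screen_sum_extend.
rewrite ler_expR card_ord; set h := weight w phi.
have h78 : 7 / 8 * eta <= h by exact: often_above.
suff : h * (- (1 / 8) + 2 * (- (1 / 8)) ^+ 2) - - (1 / 8) * (eta / 2) <= - (eta / 64).
  by move=> /(ler_wpM2l (ltW n0)); rewrite /kappa; lra.
have : (0 : R) <= eta by exact: ltW.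
by move: h78; lra.
Qed.

Section Level.
Variable t0 : nat.
Hypothesis above_t0 : eta / 4 <= weight w (fun r => (t0 <= row_screen r)%N).
Hypothesis above_t0S : weight w (fun r => (t0 < row_screen r)%N) < eta / 4.

Lemma threshold_high_prob :
  prod_weight w (fun z => (t0 < theta z)%N) <= expR (- (eta * n%:R / 64)).
Proof.
pose phi (r : row) := (t0 < row_screen r)%N.
(* This tilt gives, per arm, at most (3/8)(eta/4) - eta/8 = -eta/32. *)
have l2 : 1 / 4 <= 2^-1 :> R by lra.
apply: le_trans (le_trans (prod_weight_chernoff w_ge0 w_sum1 predT phi kappa l2) _).
  apply: prod_weight_le => // z lt.
  rewrite ler_wpM2l//; rewrite leNgt; apply/negP => lt2.
  move: lt; rewrite ltnNge => /negP; apply; apply: threshold_le.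
  apply: le_lt_trans lt2; rewrite ler_nat; apply: leq_sum => i _.
  by rewrite screen_sum_extend.
rewrite ler_expR card_ord; set h := weight w phi.
have h4 : h < eta / 4 by exact: above_t0S.
suff : h * (1 / 4 + 2 * (1 / 4) ^+ 2) - (1 / 4) * (eta / 2) <= - (eta / 64).
  by move=> /(ler_wpM2l (ltW n0)); rewrite /kappa; lra.
have : (0 : R) <= eta by exact: ltW.
by move: h4; lra.
Qed.

Lemma row_sure_weight : eta / 8 <= weight w (row_sure t0).
Proof.
have : weight w (fun r => (t0 <= row_screen r)%N) <=
    weight w (row_sure t0) + weight w (row_discrepant e).
  rewrite /weight !(big_mkcond (fun r => (t0 <= _)%N)) (big_mkcond (row_sure t0)).
  rewrite (big_mkcond (row_discrepant e)) -big_split /=; apply: ler_sum => r _.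
  rewrite /row_sure; have := w_ge0 r.
  by case: (t0 <= _)%N; case: row_discrepant => /=; lra.
by move: above_t0 rare_discrepant (ltW eta0); lra.
Qed.

Let fail := weight w (predC (row_sure t0)).

Let fail_bounds : 0 <= fail <= 1 - eta / 8.
Proof.
rewrite /fail weight_ge0// weightC//=.
by have := row_sure_weight; lra.
Qed.

Lemma none_sure_prob :
  prod_weight w (fun z : {ffun 'I_n -> row} => [forall i, ~~ row_sure t0 (z i)]) <=
  expR (- (eta * n%:R / 8)).
Proof.
rewrite (prod_weight_forall w (fun (i : 'I_n) r => ~~ row_sure t0 r)).
rewrite prodr_const card_ord -/fail.
have -> : - (eta * n%:R / 8) = n%:R * (- (eta / 8)) by lra.
rewrite expRM_natl; case/andP: fail_bounds => f0 f1.
apply: lerXn2r; rewrite ?nnegrE ?expR_ge0//.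
by apply: le_trans (expR_ge1Dx _).
Qed.

(** The event is a product of conditions on single rows: not sure before [i], discrepant at [i],
    unconstrained after [i]. *)
Lemma reached_discrepant_prob (i : 'I_n) :
  prod_weight w (fun z : {ffun 'I_n -> row} =>
    [forall j : 'I_n, (j < i)%N ==> ~~ row_sure t0 (z j)] && row_discrepant e (z i)) =
  fail ^+ i * weight w (row_discrepant e).
Proof.
pose phi (j : 'I_n) (r : row) := ((j < i)%N ==> ~~ row_sure t0 r) &&
  ((j == i) ==> row_discrepant e r).
transitivity (prod_weight w (fun z : {ffun 'I_n -> row} => [forall j, phi j (z j)])).
  apply: eq_bigl => z; apply/andP/forallP.
    by move=> [/forallP H1 H2] j; rewrite /phi H1 /=; apply/implyP => /eqP ->.
  move=> H; split; last by have /andP[_] := H i; rewrite eqxx.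
  by apply/forallP => j; have /andP[] := H j.
rewrite prod_weight_forall (bigD1 i)//= mulrC; congr (_ * _); last first.
  by apply: eq_bigl => r; rewrite /phi ltnn eqxx.
transitivity (\prod_(j < n | (j < i)%N) fail); last first.
  by rewrite prodr_const card_ord_lt// ltnW.
rewrite [RHS]big_mkcond [LHS]big_mkcond; apply: eq_bigr => j _.
case: (ltngtP j i) => [ji|ij|/val_inj ->]; rewrite ?eqxx//.
- have ne : j != i by apply: contraTneq ji => ->; rewrite ltnn.
  by rewrite ne; apply: eq_bigl => r; rewrite /phi ji (negbTE ne) andbT.
- have ne : j != i by apply: contraTneq ij => ->; rewrite ltnn.
  rewrite ne -w_sum1; apply: eq_bigl => r.
  by rewrite /phi (negbTE ne) ltnNge (ltnW ij).
Qed.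

Lemma expected_tests :
  \sum_(z : {ffun 'I_n -> row})
    (\sum_(i < n) tested n (candidate n m1 m2 kappa) (passes n m1 m2 kappa e)
       (extend z) i)%N%:R * \prod_i w (z i) <=
  2 + n%:R * expR (- (eta * n%:R / 64)).
Proof.
pose Q (i : 'I_n) (z : {ffun 'I_n -> row}) :=
  [forall j : 'I_n, (j < i)%N ==> ~~ row_sure t0 (z j)] && row_discrepant e (z i).
(* If the threshold is at most [t0], [nb_tested_le] applies; otherwise all [n] arms are charged,
   which is rare. *)
apply: (@le_trans _ _ (\sum_(z : {ffun 'I_n -> row})
  (1 + n%:R * (t0 < theta z)%N%:R + \sum_(i < n) (Q i z)%:R) * \prod_i w (z i))).
  apply: ler_sum => z _; apply: ler_wpM2r; first exact: prodr_ge0.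
  case: (leqP (theta z) t0) => th.
    rewrite mulr0 addr0 -natr_sum nat1r -add1n ler_nat.
    apply: leq_trans (nb_tested_le _ th) _; rewrite leq_add2l.
    apply: leq_sum => i _; rewrite discrepant_extend.
    rewrite /Q; case: (row_discrepant e (z i)); rewrite ?andbF ?andbT//.
    rewrite (_ : [forall j, _] = [forall j : 'I_n, (j < i)%N ==> ~~ row_sure t0 (z j)])//.
    by apply: eq_forallb => j; rewrite sure_accept_extend.
  rewrite mulr1; apply: (@le_trans _ _ n%:R).
    rewrite ler_nat -[leqRHS](card_ord n) -sum1_card; apply: leq_sum => i _.
    by case: tested.
  have : 0 <= \sum_(i < n) (Q i z)%:R :> R by apply: sumr_ge0.
  by lra.
under eq_bigr do rewrite !mulrDl mul1r mulr_suml.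
rewrite !big_split /= (_ : \sum_(z : {ffun 'I_n -> row}) \prod_i w (z i) = 1); last first.
  exact: (@prod_weightT R 'I_n row w w_sum1).
rewrite (_ : 2 = 1 + 1) // -addrA [leRHS]addrAC -addrA lerD2l [leLHS]addrC [leRHS]addrC; apply: lerD.
  rewrite exchange_big /=.
  have -> : \sum_(i < n) \sum_(z : {ffun 'I_n -> row}) (Q i z)%:R * \prod_i w (z i) =
      \sum_(i < n) fail ^+ i * weight w (row_discrepant e).
    apply: eq_bigr => i _; rewrite -reached_discrepant_prob /prod_weight [RHS]big_mkcond.
    by apply: eq_bigr => z _; rewrite -/(Q i z); case: (Q i z); rewrite ?mul1r ?mul0r.
  rewrite -mulr_suml mulrC; case/andP: fail_bounds => f0 f1.
  have f1' : fail <= 1 by have := eta0; lra.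
  have f01 : 0 <= fail <= 1 by rewrite f0.
  (* The discrepancy probability is at most eta/16, hence at most eta/8 <= 1 - [fail], and the
     geometric series contributes at most 1. *)
  apply: le_trans (geometric_sum_le n f01); apply: ler_wpM2r.
    by apply: sumr_ge0 => i _; rewrite exprn_ge0.
  by move: rare_discrepant f1 eta0; lra.
have -> : \sum_(z : {ffun 'I_n -> row}) n%:R * (t0 < theta z)%N%:R * \prod_i w (z i) =
    n%:R * prod_weight w (fun z => (t0 < theta z)%N).
  rewrite /prod_weight mulr_sumr [RHS]big_mkcond; apply: eq_bigr => z _.
  by case: (t0 < _)%N; rewrite ?mulr1 ?mulr0 ?mul0r.
by rewrite ler_wpM2l//; exact: threshold_high_prob.
Qed.

End Level.

(** The true upper eta/4-quantile of the screening sum: the tail is 1 at level 0 and vanishes at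
    [m1.+1]. *)
Lemma level_exists : exists2 t0 : nat,
  eta / 4 <= weight w (fun r => (t0 <= row_screen r)%N) &
  weight w (fun r => (t0 < row_screen r)%N) < eta / 4.
Proof.
case/andP: eta01 => _ eta1.
have [||t Qt] := @last_true (fun t => eta / 4 <= weight w (fun r => (t <= row_screen r)%N))
  m1.+1.
- by rewrite /weight w_sum1; lra.
- rewrite -ltNge /weight big_pred0 ?divr_gt0// => r.
  apply/negbTE; rewrite -leqNgt -[leqRHS](card_screen m1 m2) -sum1_card.
  by apply: leq_sum => k _; case: (r k).
by rewrite -ltNge => Qt1; exists t.
Qed.

End FiniteAnalysis.

(** * Guarantees *)

Section RowLaw.
Context (R : realType) (mu : probability R R) (d : measure_display)
  (Omega : measurableType d) (P : probability Omega R) (p : nat -> Omega -> R)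
  (X : nat -> nat -> Omega -> bool) (U : Omega -> R).
Hypothesis model : bandit_model mu P p X U.
Hypothesis mu01 : mu `[0, 1]%classic = 1%E.
Variable M : nat.
Implicit Type phi : pred {ffun 'I_M -> bool}.

(* [row_weight] does not depend on the arm, so arm 0 represents all of them. *)
Lemma row_law1 phi :
  P [set w | phi (reward_row X M 0 w)] = (weight (row_weight mu (M := M)) phi)%:E.
Proof.
have := table_law model mu01 (fun z : {ffun 'I_1 -> {ffun 'I_M -> bool}} =>
  [forall i, phi (z i)]).
rewrite (prod_weight_forall _ (fun (i : 'I_1) r => phi r)) big_ord1 => <-; congr (P _).
apply/seteqP; split=> w /= H.
  by apply/forallP => i; rewrite ord1 !ffunE.
by have /forallP /(_ ord0) := H; rewrite ffunE.
Qed.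

Lemma row_weight_sum1 : \sum_(r : {ffun 'I_M -> bool}) row_weight mu r = 1 :> R.
Proof.
have := row_law1 predT; rewrite (_ : [set w | _] = setT); last by apply/seteqP; split.
by rewrite probability_setT => -[].
Qed.

Lemma row_weight_le phi (c : R) : 0 <= c ->
  (forall t, 0 <= t <= 1 -> prod_weight (bern t) phi <= c) ->
  weight (row_weight mu (M := M)) phi <= c.
Proof.
move=> c0 H; rewrite -lee_fin -row_law1.
have := arm_event_le model mu01 0 (B := setT) measurableT c0 (fun t _ => H t).
by rewrite (_ : [set w | _ /\ _] = [set w | phi (reward_row X M 0 w)])//;
  apply/seteqP; split=> w /=; tauto.
Qed.

(** If the mean lies in [B], then either [phi] holds or the row deviates from its mean, which
    [arm_event_le] bounds. *)
Lemma row_weight_ge phi (B : set R) (c : R) : measurable B -> 0 <= c ->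
  (forall t, B t -> 0 <= t <= 1 -> prod_weight (bern t) (fun r => ~~ phi r) <= c) ->
  (mu B <= (weight (row_weight mu (M := M)) phi + c)%:E)%E.
Proof.
move=> mB c0 H.
have <- : P [set w | B (p 0 w)] = mu B.
  have := @means_law _ _ _ _ _ _ _ _ model [:: 0%N] (fun=> B) erefl (fun=> mB).
  rewrite big_seq1 fineK ?fin_num_measure// => <-; congr (P _).
  apply/seteqP; split=> w /= Bw; last by apply: Bw; rewrite inE.
  by move=> i; rewrite inE => /eqP ->.
rewrite EFinD -row_law1.
have mrow := measurable_row model (M := M) 0.
have mS : measurable [set w | B (p 0 w) /\ ~~ phi (reward_row X M 0 w)].
  apply: measurableI; first exact: (measurable_mean model 0 mB).
  exact: (measurable_finite_valued mrow (fun r => ~~ phi r)).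
have mphi := measurable_finite_valued mrow phi.
apply: le_trans (leeD (le_refl _) (arm_event_le model mu01 0 mB c0 H)).
apply: le_trans (measureU2 P mphi mS); apply: le_measure; rewrite ?inE.
- exact: (measurable_mean model 0 mB).
- exact: measurableU.
move=> w /= Bw; case: (boolP (phi _)) => h; [by left|by right].
Qed.

End RowLaw.

Lemma mass_above_quantile (R : realType) (mu : probability R R) (eta a : R) :
  mu `[0, 1]%classic = 1%E -> eta < 1 -> a < Gmu_inv mu (1 - eta) ->
  (eta%:E <= mu `]a, +oo[%classic)%E.
Proof.
move=> mu01 eta1 aq.
(* The infimum is genuine: for negative tau the interval [0, tau] is empty, with mass 0 < 1 -
   eta. *)
have lb : has_lbound [set tau : R | ((1 - eta)%:E <= Gmu mu tau)%E].
  exists 0 => tau /= le; rewrite leNgt; apply/negP => t0; move: le.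
  rewrite /Gmu set_itv_ge ?bnd_simp -?ltNge// measure0 lee_fin; lra.
have lt : (Gmu mu a < (1 - eta)%:E)%E.
  rewrite ltNge; apply/negP => le; have := ge_inf lb le.
  by rewrite leNgt aq.
have : (1 <= mu `[0%R, a]%classic + mu `]a, +oo[%classic)%E.
  have m1 : measurable (`[0%R, a]%classic : set R) by exact: measurable_itv.
  have m2 : measurable (`]a, +oo[%classic : set R) by exact: measurable_itv.
  rewrite -mu01; apply: le_trans (measureU2 mu m1 m2).
  apply: le_measure; rewrite ?inE//; first exact: measurableU.
  move=> t /=; rewrite !in_itv /= => /andP[t0 _]; rewrite t0 andbT.
  by case: (leP t a) => h; [left|right].
move: lt; rewrite /Gmu.
rewrite -(fineK (fin_num_measure mu `[0%R, a]%classic (measurable_itv _))).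
rewrite -(fineK (fin_num_measure mu `]a, +oo[%classic (measurable_itv _))).
by rewrite -EFinD !lee_fin lte_fin; lra.
Qed.

(** * Elementary bounds on logarithms, powers and rounding *)

Section Numerics.
Variable R : realType.

Lemma ln_inv_ge (x : R) : 0 < x <= 1 / 2 -> 1 / 2 <= ln (1 / x).
Proof.
case/andP=> x0 x2; rewrite -[leLHS]expRK ler_ln ?posrE ?expR_gt0 ?divr_gt0//.
(* The quadratic bound at 1/2 reads exp(1/2) <= 1 + 1/2 + 1/2 = 2 <= 1/x. *)
have h : (1 / 2 : R) <= 2^-1 by lra.
apply: (le_trans (expR_le_quad h)); rewrite ler_pdivlMr//; nra.
Qed.

Lemma expR_ln_inv (x : R) k : 0 < x -> expR (- (k%:R * ln (1 / x))) = x ^+ k.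
Proof.
move=> x0; rewrite div1r lnV ?posrE// mulrN opprK expRM_natl lnK ?posrE//.
Qed.

Lemma ln_inv_lt (x : R) : 0 < x -> ln (1 / x) * x <= 1.
Proof.
by move=> x0; rewrite -ler_pdivlMr// ltW// ln_sublinear// divr_gt0.
Qed.

Lemma truncnS_bounds (x : R) : 1 <= x ->
  x <= (Num.truncn x).+1%:R <= 2 * x.
Proof.
move=> x1; have x0 : 0 <= x by lra.
rewrite (ltW (truncnS_gt _)) /= -nat1r.
have := truncn_le x; rewrite x0 => h; lra.
Qed.

Lemma expr_le_half (x : R) k : 0 <= x <= 1 / 2 -> x ^+ k <= (1 / 2) ^+ k.
Proof. by case/andP => x0 x2; apply: lerXn2r; rewrite ?nnegrE//; lra. Qed.

End Numerics.

(** * Expected budget and correctness in the bandit model *)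

Section Guarantees.
Context (R : realType) (mu : probability R R) (d : measure_display)
  (Omega : measurableType d) (P : probability Omega R) (p : nat -> Omega -> R)
  (X : nat -> nat -> Omega -> bool) (U : Omega -> R).
Hypothesis model : bandit_model mu P p X U.
Hypothesis mu01 : mu `[0, 1]%classic = 1%E.
Variables (n m1 m2 : nat) (eta e : R).
Hypotheses (n_gt0 : (0 < n)%N) (m1_gt0 : (0 < m1)%N) (m2_gt0 : (0 < m2)%N).
Hypotheses (eta01 : 0 < eta <= 1 / 2) (e02 : 0 < e <= 2).

Let c1 : R := expR (- (m1%:R * e ^+ 2 / 8)).
Let c2 : R := expR (- (m2%:R * e ^+ 2 / 8)).
Hypothesis small_tails : c1 + c2 <= eta / 16.

Let kappa : R := eta * n%:R / 2.
Let cand := candidate n m1 m2 kappa.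
Let pass := passes n m1 m2 kappa e.
Let A := @screen_and_test R n m1 m2 cand pass.
Let q := Gmu_inv mu (1 - eta).
Let a : R := (q - 2 * e) * m1%:R.
Let wt := row_weight mu (M := m1 + m2).
Let tab w := reward_table X n (m1 + m2) w.

Let cl := @candidate_local R n m1 m2 kappa.
Let pl := @passes_local R n m1 m2 kappa e.

Let eta0 : 0 < eta. Proof. by case/andP: eta01. Qed.
Let eta1 : eta <= 1 / 2. Proof. by case/andP: eta01. Qed.
Let eta01' : 0 < eta <= 1. Proof. by rewrite eta0; move: eta1; lra. Qed.
Let e0 : 0 < e. Proof. by case/andP: e02. Qed.
Let c1_ge0 : 0 <= c1. Proof. exact: expR_ge0. Qed.
Let c2_ge0 : 0 <= c2. Proof. exact: expR_ge0. Qed.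
Let wt_ge0 r : 0 <= wt r. Proof. exact: row_weight_ge0. Qed.
Let wt_sum1 : \sum_r wt r = 1. Proof. exact: (row_weight_sum1 model mu01). Qed.

Let tabE w j k : (j < n)%N -> (k < m1 + m2)%N -> X j k w = extend (tab w) j k.
Proof.
move=> jn km; have := extendE (tab w) (Ordinal jn) (Ordinal km).
by rewrite /= !ffunE /= => ->.
Qed.

Let rare_discrepant : weight wt (row_discrepant e) <= eta / 16.
Proof.
apply: le_trans small_tails; apply: (row_weight_le model mu01); first exact: addr_ge0.
by move=> t t01; exact: row_discrepant_tail.
Qed.

Let often_above : 7 / 8 * eta <= weight wt (fun r => a <= (row_screen r)%:R).
Proof.
have mB : measurable (`]q - e, +oo[%classic : set R) by exact: measurable_itv.
have qe : q - e < q by rewrite ltrBlDr ltrDl.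
have eta_lt1 : eta < 1 by move: eta1; lra.
(* Means above q - e have mass at least eta, and such an arm misses (q - 2e) m1 with probability at
   most [c1] <= eta/16. *)
suff : eta <= weight wt (fun r => a <= (row_screen r)%:R) + c1.
  by move: small_tails c2_ge0 (ltW eta0); lra.
rewrite -lee_fin; apply: le_trans (mass_above_quantile mu01 eta_lt1 qe) _.
apply: (row_weight_ge model mu01 mB c1_ge0) => t; rewrite /= in_itv /= andbT => tq t01.
apply: le_trans (row_screen_lower_tail m1 m2 e02 t01); apply: prod_weight_le.
  by move=> b; have /andP[] := bern_bounds b t01.
move=> r; rewrite -ltNge => /ltW /le_trans; apply.
by rewrite /a ler_wpM2r//; lra.
Qed.

Lemma screen_and_test_budget :
  (\int[P]_w sample_complexity A (U w) (fun j k => X j k w) <=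
   (n%:R * m1%:R + m2%:R * (2 + n%:R * expR (- (eta * n%:R / 64))))%:E)%E.
Proof.
pose f (z : {ffun 'I_n -> {ffun 'I_(m1 + m2) -> bool}}) : R :=
  (pull_budget n m1 m2 cand pass (extend z))%:R.
apply: (@le_trans _ _ (\int[P]_w (f (tab w))%:E)%E).
  apply: ge0_le_integralT => w.
    apply: ereal_sup_ubound; exists 0%N => //=.
  apply: le_trans (sample_complexity_screen_and_test cl pl _ _) _.
  rewrite lee_fin ler_nat (pull_budget_local cl pl (y := extend (tab w)))//.
  by move=> j k jn km; exact: tabE.
rewrite (integral_table model mu01)// lee_fin.
have [t0 h1 h2] := level_exists wt_sum1 eta01'.
have fE z : f z = n%:R * m1%:R + m2%:R *
    (\sum_(i < n) tested n cand pass (extend z) i)%N%:R.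
  rewrite /f /pull_budget big_split /= sum_nat_const card_ord -big_distrr /=.
  by rewrite natrD !natrM.
under eq_bigr do rewrite fE mulrDl.
rewrite big_split /= -mulr_sumr.
have -> : \sum_(z : {ffun 'I_n -> {ffun 'I_(m1 + m2) -> bool}}) \prod_i row_weight mu (z i) = 1.
  exact: (@prod_weightT R 'I_n _ wt wt_sum1).
rewrite mulr1 lerD2l; under eq_bigr do rewrite -mulrA.
rewrite -mulr_sumr ler_wpM2l//.
exact: (expected_tests wt_ge0 wt_sum1 n_gt0 eta01' rare_discrepant h1 h2).
Qed.

(** Outside the exceptional set [N] some arm is surely accepted, so there is an output. Its test
    average is at least theta/m1 - 2e >= q - 4e, so a mean below q - 5e would make it a bad arm. *)
Lemma screen_and_test_pac :
  ((1 - (2 * expR (- (eta * n%:R / 64)) + expR (- (eta * n%:R / 8)) + n%:R * c2))%:E <=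
   P [set w | exists i, outputs A (U w) (fun j k => X j k w) i /\
                        (q - 5 * e <= p i w)%R])%E.
Proof.
have [t0 h1 h2] := level_exists wt_sum1 eta01'.
pose theta (z : {ffun 'I_n -> {ffun 'I_(m1 + m2) -> bool}}) :=
  threshold n m1 m2 kappa (extend z).
pose low z := (theta z)%:R < a.
pose high z := (t0 < theta z)%N.
pose none (z : {ffun 'I_n -> {ffun 'I_(m1 + m2) -> bool}}) :=
  [forall i, ~~ row_sure e t0 (z i)].
pose bad_table z := (low z || high z) || none z.
(* Stated for a fixed arm and without the random threshold, so that a union bound over the [n] arms
   covers the selected one. *)
pose bad_arm i := [set w | p i w < q - 5 * e /\
  (q - 4 * e) * m2%:R <= (row_test (reward_row X (m1 + m2) i w))%:R].
pose N := [set w | bad_table (tab w)] `|` \big[setU/set0]_(i < n) bad_arm i.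
have mtab := measurable_table model (n := n) (M := m1 + m2).
have mbad : measurable [set w | bad_table (tab w)].
  exact: measurable_finite_valued mtab bad_table.
have mB : measurable (`]-oo, q - 5 * e[%classic : set R) by exact: measurable_itv.
pose good_test (r : {ffun 'I_(m1 + m2) -> bool}) : bool :=
  (q - 4 * e) * m2%:R <= (row_test r)%:R.
have armE i : bad_arm i = [set w | (`]-oo, q - 5 * e[%classic : set R) (p i w) /\
    good_test (reward_row X (m1 + m2) i w)].
  by apply/seteqP; split=> w /=; rewrite in_itv.
have marm i : measurable (bad_arm i).
  rewrite armE; apply: measurableI; first exact: (measurable_mean model i mB).
  exact: (measurable_finite_valued (measurable_row model i) good_test).
have marms : measurable (\big[setU/set0]_(i < n) bad_arm i).
  by apply: bigsetU_measurable => i _; exact: marm.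
have mN : measurable N by exact: measurableU.
have Parm i : (P (bad_arm i) <= c2%:E)%E.
  rewrite armE; apply: (@arm_event_le _ _ _ _ _ _ _ _ model mu01 _ i _ good_test _ mB c2_ge0) => t.
  rewrite /= in_itv /= => tq t01.
  apply: le_trans (row_test_upper_tail m1 m2 e02 t01); apply: prod_weight_le.
    by move=> b; have /andP[] := bern_bounds b t01.
  move=> r; apply: le_trans; rewrite ler_wpM2r//; lra.
have Ptab : (P [set w | bad_table (tab w)] <=
    (2 * expR (- (eta * n%:R / 64)) + expR (- (eta * n%:R / 8)))%:E)%E.
  rewrite (table_law model mu01 bad_table) lee_fin.
  apply: le_trans (prod_weightU wt_ge0 (fun z => low z || high z) none) _.
  apply: lerD; last first.
    exact: (none_sure_prob n wt_ge0 wt_sum1 eta01' rare_discrepant h1).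
  apply: le_trans (prod_weightU wt_ge0 low high) _.
  have lo : prod_weight wt low <= _ :=
    threshold_low_prob wt_ge0 wt_sum1 n_gt0 eta01' often_above.
  have hi : prod_weight wt high <= _ :=
    threshold_high_prob wt_ge0 wt_sum1 n_gt0 eta01' h2.
  by apply: le_trans (lerD lo hi) _; lra.
have Parms : (P (\big[setU/set0]_(i < n) bad_arm i) <= (n%:R * c2)%:E)%E.
  apply: le_trans (Boole_inequality P (fun i _ => marm i)) _.
  apply: (@le_trans _ _ (\sum_(i < n) c2%:E)%E).
    by apply: lee_sum => i _; exact: Parm.
  by rewrite sumEFin lee_fin sumr_const card_ord mulr_natl.
have PN : (P N <= (2 * expR (- (eta * n%:R / 64)) + expR (- (eta * n%:R / 8)) +
    n%:R * c2)%:E)%E.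
  apply: le_trans (measureU2 P mbad marms) _.
  by rewrite [in leRHS]EFinD; exact: leeD.
pose S := [set w | exists i, outputs A (U w) (fun j k => X j k w) i /\ q - 5 * e <= p i w].
have accE w : accepted n cand pass (fun j k => X j k w) =
    accepted n cand pass (extend (tab w)).
  rewrite /accepted (first_accepted_local cl pl (y := extend (tab w)))//.
  by move=> j k jn km; exact: tabE.
have mS : measurable S.
  rewrite (_ : S = \bigcup_i ([set w | accepted n cand pass (extend (tab w)) == Some i] `&`
      [set w | (`[q - 5 * e, +oo[%classic : set R) (p i w)])).
    apply: bigcup_measurable => i _; apply: measurableI.
      exact: (measurable_finite_valued mtab
        (fun z => accepted n cand pass (extend z) == Some i)).
    by apply: (measurable_mean model i); exact: measurable_itv.
  apply/seteqP; split=> w.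
    move=> [i [/(outputs_screen_and_test cl pl) ai pi]]; exists i => //; split.
      by apply/eqP; rewrite -accE.
    by rewrite /= in_itv /= andbT.
  move=> [i _ [/eqP ai]]; rewrite /= in_itv /= andbT => pi; exists i; split=> //.
  by apply/(outputs_screen_and_test cl pl); rewrite accE.
have NS : ~` N `<=` S.
  move=> w /not_orP[/negP + narm]; rewrite !negb_or => /andP[/andP[nlow nhigh]].
  rewrite /none negb_forall => /existsP[i]; rewrite negbK => /andP[ti di].
  move: nlow nhigh; rewrite /low /high -leNgt -leqNgt => athe thet.
  set x := extend (tab w); have acc : cand x i && pass x i.
    apply: (above_threshold_accepted (t := t0)) => //.
      by rewrite screen_sum_extend.
    by rewrite discrepant_extend.
  pose j := first_accepted n cand pass x.
  have jn : (j < n)%N by apply: leq_ltn_trans (ltn_ord i); exact: find_iota_min.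
  have /andP[_ pj] := find_iota_true jn.
  exists j; split.
    by apply/(outputs_screen_and_test cl pl); rewrite accE /accepted -/j jn.
  rewrite leNgt; apply/negP => pj5; apply: narm.
  rewrite -bigcup_mkord; exists j => //; split=> //.
  have tE : test_sum m1 m2 x j = row_test (reward_row X (m1 + m2) j w).
    by have := test_sum_extend (tab w) (Ordinal jn); rewrite ffunE.
  rewrite -tE -ler_pdivlMr ?ltr0n//; apply: le_trans pj.
  have : q - 2 * e <= (threshold n m1 m2 kappa x)%:R / m1%:R.
    by rewrite ler_pdivlMr ?ltr0n.
  by lra.
apply: (@le_trans _ _ (P (~` N))).
  by rewrite probability_setC// EFinB; exact: leeB.
by apply: le_measure; rewrite ?inE//; exact: measurableC.
Qed.

End Guarantees.

(** * Arithmetic of the sample sizes *)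

Section SampleSizes.
Variable R : realType.

Lemma truncnS_scale (c y : R) : 0 < y <= 1 -> 1 <= c ->
  c <= (Num.truncn (c / y)).+1%:R * y <= 2 * c.
Proof.
move=> /andP[y0 y1] c1; have : 1 <= c / y by rewrite ler_pdivlMr//; lra.
by move/truncnS_bounds; rewrite ler_pdivrMr// mulrA ler_pdivlMr.
Qed.

(** The union bound costs N, of order L/eta. The spare powers in [c2] absorb it: one eta cancels
    1/eta, one delta cancels L, and delta^9 eta^5 beats the constant. *)
Lemma total_failure_le (eta delta L N c2 x1 x2 : R) :
  0 < eta <= 1 / 2 -> 0 < delta <= 1 / 2 -> 0 <= L -> L * delta <= 1 ->
  0 <= N -> N * eta <= 16 * 64 * L ->
  c2 <= eta ^+ 6 * delta ^+ 10 -> x1 <= delta ^+ 8 -> x2 <= delta ^+ 8 ->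
  2 * x1 + x2 + N * c2 <= delta.
Proof.
move=> /andP[eta0 eta2] /andP[delta0 delta2] L0 Ld N0 Ne hc h1 h2.
have d7 : delta ^+ 7 <= (1 / 2) ^+ 7 by apply: expr_le_half; rewrite (ltW delta0).
have d8 : delta ^+ 8 <= (1 / 2) ^+ 8 by apply: expr_le_half; rewrite (ltW delta0).
have e5 : eta ^+ 5 <= (1 / 2) ^+ 5 by apply: expr_le_half; rewrite (ltW eta0).
have d8' : delta ^+ 8 <= delta * (1 / 2) ^+ 7 by rewrite exprS ler_wpM2l// ltW.
have d9 : delta ^+ 9 <= delta * (1 / 2) ^+ 8 by rewrite exprS ler_wpM2l// ltW.
suff : N * c2 <= 16 * 64 * ((1 / 2) ^+ 5 * delta ^+ 9).
  by clear -h1 h2 d8' d9 delta0; lra.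
apply: le_trans (ler_wpM2l N0 hc) _.
have -> : N * (eta ^+ 6 * delta ^+ 10) = (N * eta) * (eta ^+ 5 * delta ^+ 10).
  by rewrite (exprS eta 5); ring.
have g0 : 0 <= eta ^+ 5 * delta ^+ 10 by rewrite mulr_ge0// exprn_ge0// ltW.
apply: le_trans (ler_wpM2r g0 Ne) _.
have -> : 16 * 64 * L * (eta ^+ 5 * delta ^+ 10) =
    16 * 64 * (eta ^+ 5 * ((L * delta) * delta ^+ 9)).
  by rewrite (exprS delta 9); ring.
have d90 : 0 <= delta ^+ 9 by rewrite exprn_ge0// ltW.
apply: ler_wpM2l; first by rewrite mulr_ge0.
apply: ler_pM => //; first by rewrite exprn_ge0// ltW.
  by rewrite !mulr_ge0// ltW.
by rewrite -[leRHS]mul1r ler_wpM2r.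
Qed.

(** Screening dominates, with order L l after scaling by eta E2. The tests contribute order l + L,
    which L, l >= 1/2 bounds by 4 L l. Numerically 1024 * 2400 + 9 * 12800 is below three
    million. *)
Lemma total_budget_le (eta delta L l N M1 K E2 x : R) :
  0 < eta <= 1 / 2 -> 0 < delta <= 1 / 2 -> L * delta <= 1 ->
  1 / 2 <= L -> 1 / 2 <= l -> 0 < E2 ->
  0 <= N -> 0 <= M1 -> 0 <= K -> 0 <= x <= delta ^+ 8 ->
  N * eta <= 16 * 64 * L -> M1 * E2 <= 24 * 100 * l -> K * E2 <= 40 * 100 * L ->
  (N * M1 + (M1 + K) * (2 + N * x)) * (eta * E2) <= 3 * 100 * 100 * 100 * (L * l).
Proof.
move=> /andP[eta0 eta2] /andP[delta0 delta2] Ld L2 l2 E20 N0 M0 K0 /andP[x0 xd] hN hM hK.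
have d7 : delta ^+ 7 <= (1 / 2) ^+ 7 by apply: expr_le_half; rewrite (ltW delta0).
have d70 : 0 <= delta ^+ 7 by rewrite exprn_ge0// ltW.
have Neta0 : 0 <= N * eta by rewrite mulr_ge0// ltW.
have nx : N * eta * x <= 8.
  apply: (le_trans (ler_pM Neta0 x0 hN xd)).
  have -> : 16 * 64 * L * delta ^+ 8 = 16 * 64 * (L * delta * delta ^+ 7).
    by rewrite (exprS delta 7); ring.
  have : L * delta * delta ^+ 7 <= 1 * delta ^+ 7 by rewrite ler_wpM2r.
  by clear -d7; lra.
have -> : (N * M1 + (M1 + K) * (2 + N * x)) * (eta * E2) =
  (N * eta) * (M1 * E2) + (M1 * E2 + K * E2) * (2 * eta + N * eta * x) by ring.
have ME0 : 0 <= M1 * E2 by rewrite mulr_ge0// ltW.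
have KE0 : 0 <= K * E2 by rewrite mulr_ge0// ltW.
have p1 : N * eta * (M1 * E2) <= 16 * 64 * L * (24 * 100 * l) by exact: ler_pM.
have p2 : (M1 * E2 + K * E2) * (2 * eta + N * eta * x) <=
    (24 * 100 * l + 40 * 100 * L) * 9.
  apply: ler_pM; [exact: addr_ge0| |exact: lerD|].
    by rewrite addr_ge0// ?mulr_ge0// ltW.
  by clear -nx eta2; lra.
have Ll1 : l <= 2 * (L * l) by clear -L2 l2; nra.
have Ll2 : L <= 2 * (L * l) by clear -L2 l2; nra.
have Ll0 : 0 <= L * l by clear -L2 l2; nra.
by clear -p1 p2 Ll1 Ll2 Ll0; lra.
Qed.

End SampleSizes.

(** * Choice of the sample sizes and conclusion *)

Theorem theorem1p1 (R : realType) :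
  exists C : R, 0 < C /\
  forall eta eps delta : R,
    0 < eta <= 1/2 -> 0 < eps <= 1/2 -> 0 < delta <= 1/2 ->
    exists A : algorithm R, alg_measurable A /\
    forall (mu : probability R R), mu `[0, 1]%classic = 1%E ->
    forall (d : measure_display) (Omega : measurableType d)
           (P : probability Omega R) (p : nat -> Omega -> R)
           (X : nat -> nat -> Omega -> bool) (U : Omega -> R),
      bandit_model mu P p X U ->
      (* (i) (eta, eps, delta)-PAC *)
      ((1 - delta)%:E <=
         P [set w | exists i, outputs A (U w) (fun j k => X j k w) i /\
                    (Gmu_inv mu (1 - eta) - eps <= p i w)%R])%E /\
      (* (ii) expected sample complexity *)
      (\int[P]_w sample_complexity A (U w) (fun j k => X j k w)
         <= (C * (ln (1 / delta) * ln (1 / eta)) / (eta * eps ^+ 2))%:E)%E.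
Proof.
exists (3 * 100 * 100 * 100); split; first by lra.
move=> eta eps delta Heta Heps Hdelta.
case/andP: (Heta) => eta0 eta2; case/andP: (Heps) => eps0 eps2.
case/andP: (Hdelta) => delta0 delta2.
set L := ln (1 / delta); set l := ln (1 / eta).
have L2 : 1 / 2 <= L by exact: ln_inv_ge.
have l2 : 1 / 2 <= l by exact: ln_inv_ge.
have Ld : L * delta <= 1 by exact: ln_inv_lt.
set E2 := eps ^+ 2; have E20 : 0 < E2 by rewrite exprn_gt0.
have E21 : 0 < E2 <= 1 by rewrite E20 /E2 /=; clear -eps0 eps2; nra.
have etab : 0 < eta <= 1 by rewrite eta0 /=; clear -eta2; lra.
(* Makes eta n/64 at least 8 L, so that the threshold deviations have probability at most
   delta^8. *)
pose n := (Num.truncn (8 * 64 * L / eta)).+1.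
have /andP[n1 n2] : 8 * 64 * L <= n%:R * eta <= 2 * (8 * 64 * L).
  by apply: truncnS_scale etab _; clear -L2; lra.
(* As e^2/8 = eps^2/200, this makes the screening exponent at least 6 l, that is [c1] <= eta^6. *)
pose m1 := (Num.truncn (12 * 100 * l / E2)).+1.
have /andP[m11 m12] : 12 * 100 * l <= m1%:R * E2 <= 2 * (12 * 100 * l).
  by apply: truncnS_scale E21 _; clear -l2; lra.
(* The extra test pulls add 10 L to the exponent, a further factor delta^10, needed for the union
   bound over arms. *)
pose k := (Num.truncn (20 * 100 * L / E2)).+1.
have /andP[k1 k2] : 20 * 100 * L <= k%:R * E2 <= 2 * (20 * 100 * L).
  by apply: truncnS_scale E21 _; clear -L2; lra.
pose m2 := (m1 + k)%N.
have m2E : m2%:R = m1%:R + k%:R :> R by rewrite natrD.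
(* Five units of loss: one for means just below the quantile, one for screening error, two for the
   passing margin, one for test error. *)
pose e := eps / 5.
have e02 : 0 < e <= 2 by rewrite /e; clear -eps0 eps2; apply/andP; split; lra.
have e2E : e ^+ 2 = E2 / 25 by rewrite /e /E2; field.
set c1 := expR (- (m1%:R * e ^+ 2 / 8)).
set c2 := expR (- (m2%:R * e ^+ 2 / 8)).
have c1le : c1 <= eta ^+ 6.
  by rewrite -expR_ln_inv// ler_expR e2E -/l; clear -m11; lra.
have c2le : c2 <= eta ^+ 6 * delta ^+ 10.
  rewrite -!expR_ln_inv// -expRD ler_expR e2E -/l -/L m2E.
  by clear -m11 k1; lra.
have x1 : expR (- (eta * n%:R / 64)) <= delta ^+ 8.
  by rewrite -expR_ln_inv// ler_expR -/L; clear -n1; lra.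
have x2 : expR (- (eta * n%:R / 8)) <= delta ^+ 8.
  by rewrite -expR_ln_inv// ler_expR -/L; clear -n1 L2; lra.
have small : c1 + c2 <= eta / 16.
  have e5 : eta ^+ 5 <= (1 / 2) ^+ 5 by apply: expr_le_half; rewrite (ltW eta0).
  have e6 : eta ^+ 6 <= eta * (1 / 2) ^+ 5 by rewrite exprS ler_wpM2l// ltW.
  have d10 : delta ^+ 10 <= 1.
    by apply: exprn_ile1; [exact: ltW|apply: le_trans delta2 _; lra].
  have : eta ^+ 6 * delta ^+ 10 <= eta ^+ 6.
    by rewrite ler_piMr// exprn_ge0// ltW.
  by clear -c1le c2le e6; lra.
have n2' : n%:R * eta <= 16 * 64 * L by clear -n2; lra.
exists (@screen_and_test R n m1 m2 (candidate n m1 m2 (eta * n%:R / 2))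
  (passes n m1 m2 (eta * n%:R / 2) e)).
split; first exact: alg_measurable_det.
move=> mu mu01 d Omega P p X U model.
have n_gt0 : (0 < n)%N by [].
have m1_gt0 : (0 < m1)%N by [].
have m2_gt0 : (0 < m2)%N by [].
split.
  have -> : eps = 5 * e by rewrite /e; field.
  apply: le_trans (screen_and_test_pac model mu01 n_gt0 m1_gt0 m2_gt0 Heta e02 small).
  rewrite lee_fin lerD2l lerN2; apply: total_failure_le Heta Hdelta _ Ld _ n2' _ x1 x2 => //.
  by clear -L2; lra.
apply: le_trans (screen_and_test_budget model mu01 n_gt0 m1_gt0 m2_gt0 Heta e02 small) _.
rewrite lee_fin ler_pdivlMr ?mulr_gt0// m2E.
apply: total_budget_le Heta Hdelta Ld L2 l2 E20 _ _ _ _ n2' _ _ => //.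
- by rewrite expR_ge0.
- by clear -m12; lra.
- by clear -k2; lra.
Qed.
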